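(* Let $R=\mathbb{Z}$ or $\mathbb{F}_p$ ($p$ a prime), let $X$ be a set, and let $\tau\colon X\to \mathsf{T}^2_R(X)$ be a map of sets. If $\tau$ is admissible, then $d_\tau^2\equiv 0$, and the map $\mathsf{T}^1_R(X)\to C^1(\Delta(M_\tau);R)$ given by $q\mapsto(\mathbf{a}\mapsto q(\mathbf{a}))$ extends uniquely to a monomorphism $$\psi_X\colon (\mathsf{T}_R(X),d_\tau)\hookrightarrow (C^*(\Delta(M_\tau);R),d_\Delta)$$ of binomial cup-one dgas.
   Context: Free binomial algebra. For a set $X$, $\mathrm{Int}(\mathbb{Z}^X)=\{q\in\mathbb{Q}[X] : q(\mathbb{Z}^X)\subseteq\mathbb{Z}\}$, and $\mathrm{Int}(\mathbb{F}_p^X)$ is the quotient of $\mathrm{Int}(\mathbb{Z}^X)$ by the ideal generated by $\zeta_n(x)=\binom{x}{n}$ ($x\in X$, $n\ge p$), tensored with $\mathbb{F}_p$. Let $\mathfrak{m}_{X,R}\subset \mathrm{Int}(R^X)$ be the submodule of polynomials with zero constant term, and $\mathsf{T}_R(X)=T^*(\mathfrak{m}_{X,R})$ the tensor algebra over $R$, with product $\cup=\otimes$ and maps $a\cup_1 b=ab$ on $\mathsf{T}^1=\mathfrak{m}_{X,R}$, $(a\otimes b)\cup_1 c=ac\otimes b+a\otimes bc$, and $(a_1\otimes a_2)\circ(b_1\otimes b_2)=a_1b_1\otimes a_2b_2$. The map $d_\tau$. For every set map $\tau\colon X\to\mathsf{T}_R^2(X)$, $d_\tau\colon\mathsf{T}_R(X)\to\mathsf{T}_R(X)$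 denotes the unique degree-1 $R$-linear map with $d_\tau(x)=\tau(x)$ for $x\in X$ satisfying the graded Leibniz rule and the $\cup_1$–$d$ formula $d(a\cup_1 b)=-a\cup b-b\cup a+da\cup_1 b+db\cup_1 a-da\circ db$ for $a,b\in\mathsf{T}^1_R(X)$. The magma $M_\tau$. Let $M=M(X,R)$ be the set of all functions $\mathbf{a}\colon X\to R$; an element $q\in\mathrm{Int}(R^X)$ is evaluated at $\mathbf a$ to give $q(\mathbf a)\in R$. Write $\tau(x)=\sum_i p_{x,i}\otimes q_{x,i}$ with $p_{x,i},q_{x,i}\in\mathfrak{m}_{X,R}$, and define $\mu_\tau\colon M\times M\to M$ by $\mu_\tau(\mathbf a,\mathbf a')(x)=\mathbf a(x)+\mathbf a'(x)-\sum_i p_{x,i}(\mathbf a)q_{x,i}(\mathbf a')$. Then $M_\tau=(M,\mu_\tau)$ is a magma with two-sided unit the zero function. $\tau$ is called admissible if $\mu_\tau$ is associative. $\Delta(M_\tau)$ and its cochains. For a semigroup $M$, $\Delta(M)$ is the $\Delta$-set with one vertex whose $n$-simplices are the $n$-tuples $(a_1,\dots,a_n)\in M^n$, the edge from vertex $i$ to vertex $j$ ($i<j$) being $a_{i+1}\cdots a_j$ (so faces are as in the bar construction). $C^*(\Delta(M);R)$ is its simplicial cochain dga with the usual coboundary $d_\Delta$ (e.g. $(d_\Delta f)(a,a')=f(a)+f(a')-f(aa')$ for 1-cochains) and cup product (front face times back face). For a $\Delta$-set it is a binomial cup-one dga with $(f\cup_1 g)(e)=f(e)g(e)$ on 1-cochains,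 $(v\circ w)(s)=v(s)w(s)$ on 2-cochains, $\cup_1$ of decomposable 2-cochains with 1-cochains given by $(a\cup b)\cup_1 c=a\cup(b\cup_1 c)+(a\cup_1 c)\cup b$, and $\zeta_n(f)(e)=\binom{f(e)}{n}$ on 1-cochains. Binomial cup-one dga. A dga over $R$ is a graded $R$-algebra $A=\bigoplus_{i\ge0}A^i$ (product $\cup$) with a degree-one map $d$, $d^2=0$, satisfying the graded Leibniz rule. $D^2(A)\subset A^2$ is the span of all $a\cup b$, $a,b\in A^1$. A cup-one dga is a dga with $R$-linear maps $\cup_1\colon A^1\otimes_R A^1\to A^1$, $\cup_1\colon D^2(A)\otimes_R A^1\to A^2$, $\circ\colon D^2(A)\otimes_R D^2(A)\to D^2(A)$ such that: (i) $R\oplus A^1$ with $\cup_1$ as multiplication on $A^1$ is a commutative $R$-algebra with identity $1\in R$; (ii) $(a\cup b)\cup_1 c=a\cup(b\cup_1 c)+(a\cup_1 c)\cup b$ for $a,b,c\in A^1$; (iii) $(u\cup v)\circ(w\cup z)=(u\cup_1 w)\cup(v\cup_1 z)$; (iv) $a\cup_1 dc=a\cup c-c\cup a$ for $a\in A^1$, $c\in A^0$; (v) the $\cup_1$–$d$ formula holds for $a,b\in A^1$ with $da,db\in D^2(A)$. It is binomial if $A^0$ (under $\cup$) and $R\oplus A^1$ (under $\cup_1$) are $R$-binomial algebras: for $R=\mathbb Z$, torsion-free commutative rings containing $\zeta_n(a)=\binom{a}{n}$ for all $a$, $n>0$; for $R=\mathbb F_p$, commutative $\mathbb F_p$-algebras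 with $a^p=a$ for all $a$ (then $\zeta_n(a)=a(a-1)\cdots(a-n+1)/n!$ is defined for $1\le n\le p-1$). Morphisms are degree-preserving dga maps commuting with $\cup_1$ on $A^1$ and with the $\zeta_n$ on $A^1$. *)

(* Defs.v *)
From HB Require Import structures.
From mathcomp Require Import all_boot all_order all_algebra.
From mathcomp Require Import finmap.
From mathcomp Require Import boolp classical_sets functions.
From mathcomp.multinomials Require Import monalg.

Set Implicit Arguments.
Unset Strict Implicit.
Unset Printing Implicit Defensive.

Import GRing.Theory Num.Theory.
Local Open Scope ring_scope.
Local Open Scope quotient_scope.

Definition lspan (R : pzRingType) (V : lmodType R) (G : V -> Prop) : {pred V} :=
  fun v => `[< exists s : seq (R * V),
    (forall rg, rg \in s -> G rg.2) /\ v = \sum_(rg <- s) rg.1 *: rg.2 >].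

Lemma lspan_closed (R : pzRingType) (V : lmodType R) (G : V -> Prop) :
  subsemimod_closed (lspan G).
Proof.
split; first split.
- by apply/asboolP; exists [::]; rewrite big_nil.
- move=> u v /asboolP[s [Gs ->]] /asboolP[t [Gt ->]]; apply/asboolP.
  exists (s ++ t); rewrite big_cat; split=> // rg.
  by rewrite mem_cat => /orP[/Gs|/Gt].
move=> r u /asboolP[s [Gs ->]]; apply/asboolP.
exists [seq (r * rg.1, rg.2) | rg <- s]; split.
  by move=> _ /mapP[rg /Gs Grg ->].
by rewrite big_map scaler_sumr; apply: eq_bigr => rg _; rewrite scalerA.
Qed.

Section IntZ.
Variable X : choiceType.

Definition Qpoly := {malg rat[{cmonom X}]}.

HB.instance Definition _ := GRing.ComAlgebra.on Qpoly.

Definition meval (a : X -> rat) (m : {cmonom X}) : rat :=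
  \prod_(x <- finsupp m) a x ^+ m x.

Lemma meval_mmorphism a : mmorphism (meval a).
Proof.
have E (m : {cmonom X}) (D : {fset X}) : (finsupp m `<=` D)%fset ->
    meval a m = \prod_(x <- D) a x ^+ m x.
  move=> sub; rewrite /meval (big_fset_incl _ sub) // => x _.
  by rewrite -cmE_neq0 negbK => /eqP->; rewrite expr0.
split=> [m n|]; last by rewrite /meval mdom1 big_seq_fset0.
pose D := (finsupp m `|` finsupp n)%fset.
rewrite (E _ D) ?mdomD // (E m D) ?fsubsetUl // (E n D) ?fsubsetUr //.
by rewrite -big_split; apply: eq_bigr => x _; rewrite cmM exprD.
Qed.

HB.instance Definition _ a :=
  isMultiplicative.Build {cmonom X} rat (meval a) (meval_mmorphism a).

Definition qeval (a : X -> rat) (q : Qpoly) : rat := mmap idfun (meval a) q.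

HB.instance Definition _ a := GRing.RMorphism.copy (qeval a)
  (mmap (idfun : {rmorphism rat -> rat}) (meval a)).

Definition qvar (x : X) : Qpoly := << ucm x >>.

Definition qbinom (q : Qpoly) (n : nat) : Qpoly :=
  (n`!%:R : rat)^-1 *: \prod_(i < n) (q - i%:R).

Definition intvalued : {pred Qpoly} := fun q =>
  `[< forall a : X -> int, exists z : int, qeval (fun x => (a x)%:~R) q = z%:~R >].

Lemma intvalued_closed : subring_closed intvalued.
Proof.
split=> [|p q /asboolP zp /asboolP zq|p q /asboolP zp /asboolP zq];
    apply/asboolP => a; last 2 first.
- have [[y py] [z qz]] := (zp a, zq a).
  by exists (y - z); rewrite rmorphB /= py qz rmorphB.
- have [[y py] [z qz]] := (zp a, zq a).
  by exists (y * z); rewrite rmorphM /= py qz rmorphM.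
by exists 1; rewrite rmorph1.
Qed.

HB.instance Definition _ :=
  GRing.isSubringClosed.Build Qpoly intvalued intvalued_closed.

Record IntZ := MkIntZ { IntZ_val :> Qpoly; _ : IntZ_val \in intvalued }.

HB.instance Definition _ := [isSub for IntZ_val].
HB.instance Definition _ := [Choice of IntZ by <:].
HB.instance Definition _ := [SubChoice_isSubComNzRing of IntZ by <:].

Definition IntZ_scale (n : int) (q : IntZ) := q *~ n.

Lemma IntZ_scaleA m n q :
  IntZ_scale m (IntZ_scale n q) = IntZ_scale (m * n) q.
Proof. exact: mulrzA_C. Qed.
Lemma IntZ_scale1 : left_id 1 IntZ_scale. Proof. by []. Qed.
Lemma IntZ_scaleDr : right_distributive IntZ_scale +%R.
Proof. by move=> n q r; apply: mulrzDl. Qed.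
Lemma IntZ_scaleDl q : {morph IntZ_scale^~ q : m n / m + n}.
Proof. by move=> m n; apply: mulrzDr. Qed.

HB.instance Definition _ := GRing.Zmodule_isLmodule.Build int IntZ
  IntZ_scaleA IntZ_scale1 IntZ_scaleDr IntZ_scaleDl.

Lemma IntZ_scaleAl (n : int) (q r : IntZ) : n *: (q * r) = n *: q * r.
Proof. by rewrite /GRing.scale /= /IntZ_scale mulrzAl. Qed.

HB.instance Definition _ := GRing.Lmodule_isLalgebra.Build int IntZ IntZ_scaleAl.
HB.instance Definition _ := GRing.Lalgebra_isComAlgebra.Build int IntZ.

Definition IntZ_eval (q : IntZ) (a : X -> int) : int :=
  numq (qeval (fun x => (a x)%:~R) q).

Lemma IntZ_evalE q a : (IntZ_eval q a)%:~R = qeval (fun x => (a x)%:~R) q.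
Proof.
by case: q => q /= qZ; case: (asboolP _ qZ a) => z qz; rewrite /IntZ_eval /= qz numq_int.
Qed.

Lemma qeval_var a x : qeval a (qvar x) = a x.
Proof.
by rewrite /qeval mmapU mul1r /meval mdomU big_seq_fset1 cmUU.
Qed.

Lemma qvar_intvalued x : qvar x \in intvalued.
Proof. by apply/asboolP => a; exists (a x); rewrite qeval_var. Qed.

Definition IntZ_var (x : X) : IntZ := MkIntZ (qvar_intvalued x).

Definition IntZ_zero_const : {pred IntZ} := fun q => mcoeff mone (val q) == 0.

End IntZ.

Section IntF.
Variables (X : choiceType) (p : nat) (p_pr : prime p).

Definition IntF_gen (g : IntZ X) : Prop :=
  (exists x n, (p <= n)%N /\ val g = qbinom (qvar x) n) \/ g = p%:R.

(* The ideal (zeta_n(x), p) for x in X and n >= p: tensoring with F_p is the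
   quotient by p. *)
Definition IntF_ideal of prime p : {pred IntZ X} :=
  lspan (V := (IntZ X)^o) IntF_gen.

Lemma IntF_ideal_closed : idealr_closed (IntF_ideal p_pr).
Proof.
have [[S0 SD] SZ] := lspan_closed (V := (IntZ X)^o) IntF_gen.
split=> //; last by move=> a u v Su Sv; apply: SD => //; apply: SZ.
pose e (q : IntZ X) := qeval (fun=> 0) (IntZ_val q).
have eD u v : e (u + v) = e u + e v by rewrite -rmorphD.
have eM u v : e (u * v) = e u * e v by rewrite -rmorphM.
apply/asboolP => -[s [Gs /(congr1 e)]].
suff [z ->] : exists z : int,
    e (\sum_(rg <- s) rg.1 *: rg.2 : (IntZ X)^o) = p%:R * z%:~R.
  rewrite /e rmorph1 -[p%:R]/((p%:Z)%:~R) -rmorphM -[1]/(1%:~R).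
  move=> /eqP; rewrite eqr_int => /eqP pz.
  have := dvdz_mulr z (dvdzz p); rewrite -pz dvdz1 absz_nat => /eqP p1.
  by have := prime_gt1 p_pr; rewrite p1.
elim: s Gs => [|[r g] s IHs] Gs.
  by exists 0; rewrite big_nil /e !rmorph0 mulr0.
have [|z Ez] := IHs; first by move=> rg srg; apply: Gs; rewrite inE srg orbT.
rewrite big_cons eD Ez.
have [y ->] : exists y : int, e (r * g) = p%:R * y%:~R.
  rewrite eM; have [/= [x [n [le_pn Eg]]]|/= ->] := Gs _ (mem_head _ _); last first.
    exists (IntZ_eval r (fun=> 0)); rewrite IntZ_evalE mulrC.
    by rewrite -[e p%:R]/((qeval (fun=> 0) \o val) p%:R) rmorph_nat.
  exists 0; rewrite mulr0 /e {}Eg /qbinom -mul_malgC rmorphM rmorph_prod /=.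
  case: n le_pn => [|n _]; first by rewrite leqNgt prime_gt0.
  have qx0 : qeval (fun=> 0) (qvar x - (ord0 : 'I_n.+1)%:R) = 0.
    by rewrite subr0 qeval_var.
  by rewrite big_ord_recl qx0 mul0r !mulr0.
by exists (y + z); rewrite rmorphD mulrDr.
Qed.

HB.instance Definition _ :=
  isIdealr.Build (IntZ X) (IntF_ideal p_pr) IntF_ideal_closed.

Definition IntF := {ideal_quot (IntF_ideal p_pr : idealr (IntZ X))}.

HB.instance Definition _ := GRing.ComNzRing.on IntF.

End IntF.
Section IntFAlg.
Variables (X : choiceType) (p : nat) (p_pr : prime p).
Local Notation F := (IntF X p_pr).

Lemma IntF_pchar : (p%:R : F) = 0.
Proof.
rewrite -(rmorph_nat (\pi_F : {rmorphism IntZ X -> F})) /=.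
rewrite -(pi_zeror (s := F)); apply/eqP; rewrite -Quotient.idealrBE subr0.
apply/asboolP; exists [:: (1, p%:R)].
rewrite big_seq1 scale1r; split=> // rg; rewrite inE => /eqP->.
by right.
Qed.

Definition IntF_scale (c : 'F_p) (q : F) : F := q *+ c.

Lemma IntF_natrFp n (q : F) : q *+ (inZp n : 'F_p) = q *+ n.
Proof.
rewrite -[in LHS](mulr_natl q) -[in RHS](mulr_natl q); congr (_ * q).
rewrite [in RHS](divn_eq n p) natrD natrM IntF_pchar mulr0 add0r.
by rewrite /= (Fp_cast p_pr).
Qed.

Lemma IntF_scaleA a b q : IntF_scale a (IntF_scale b q) = IntF_scale (a * b) q.
Proof. by rewrite /IntF_scale IntF_natrFp -mulrnA mulnC. Qed.
Lemma IntF_scale1 : left_id 1 IntF_scale.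
Proof. by move=> q; rewrite /IntF_scale mulr1n. Qed.
Lemma IntF_scaleDr : right_distributive IntF_scale +%R.
Proof. by move=> a q r; rewrite /IntF_scale mulrnDl. Qed.
Lemma IntF_scaleDl q : {morph IntF_scale^~ q : a b / a + b}.
Proof. by move=> a b; rewrite /IntF_scale IntF_natrFp mulrnDr. Qed.

HB.instance Definition _ := GRing.Zmodule_isLmodule.Build 'F_p F
  IntF_scaleA IntF_scale1 IntF_scaleDr IntF_scaleDl.

Lemma IntF_scaleAl (a : 'F_p) (q r : F) : a *: (q * r) = a *: q * r.
Proof. by rewrite /GRing.scale /= /IntF_scale mulrnAl. Qed.

HB.instance Definition _ := GRing.Lmodule_isLalgebra.Build 'F_p F IntF_scaleAl.
HB.instance Definition _ := GRing.Lalgebra_isComAlgebra.Build 'F_p F.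

(* Evaluation at the lift of a with values in {0, .., p-1}: zeta_n vanishes there
   for n >= p, so the result does not depend on the representative. *)
Definition IntF_eval (q : F) (a : X -> 'F_p) : 'F_p :=
  (IntZ_eval (repr q) (fun x => (a x : nat)%:Z))%:~R.

Definition IntF_var (x : X) : F := \pi_F (IntZ_var x).

(* The image of the polynomials in Int(Z^X) with zero constant term. *)
Definition IntF_zero_const : {pred F} :=
  fun q => `[< exists2 r, r \in @IntZ_zero_const X & \pi_F r = q >].

End IntFAlg.

Inductive coef := CoefZ | CoefF (p : nat) of prime p.

Definition coef_ring (k : coef) : comNzRingType :=
  match k with CoefZ => int | CoefF p _ => 'F_p end.

Definition IntR (k : coef) (X : choiceType) : comAlgType (coef_ring k) :=
  match k with CoefZ => IntZ X | CoefF p p_pr => IntF X p_pr end.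

Definition IntR_eval (k : coef) (X : choiceType) : IntR k X -> (X -> coef_ring k) -> coef_ring k :=
  match k with
  | CoefZ => @IntZ_eval X
  | CoefF p p_pr => @IntF_eval X p p_pr
  end.

Definition IntR_var (k : coef) (X : choiceType) : X -> IntR k X :=
  match k with
  | CoefZ => @IntZ_var X
  | CoefF p p_pr => @IntF_var X p p_pr
  end.

Definition zero_const (k : coef) (X : choiceType) : {pred IntR k X} :=
  match k with
  | CoefZ => @IntZ_zero_const X
  | CoefF p p_pr => @IntF_zero_const X p p_pr
  end.

Section AugmentationIdeal.
Variables (k : coef) (X : choiceType).

Lemma IntZ_zero_constD (q r : IntZ X) : q \in @IntZ_zero_const X ->
  r \in @IntZ_zero_const X -> q + r \in @IntZ_zero_const X.
Proof.
by rewrite !unfold_in /= mcoeffD => /eqP-> /eqP->; rewrite addr0.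
Qed.

Lemma IntZ_zero_constM (q r : IntZ X) :
  r \in @IntZ_zero_const X -> q * r \in @IntZ_zero_const X.
Proof.
rewrite !unfold_in /= => /eqP r0.
by rewrite (rmorphM (mcoeff (mone : {cmonom X}))) /= r0 mulr0.
Qed.

Lemma zero_constM (q r : IntR k X) :
  r \in @zero_const k X -> q * r \in @zero_const k X.
Proof.
case: k q r => [|p p_pr] q r; first exact: IntZ_zero_constM.
move=> /asboolP[r' r'0 <-]; apply/asboolP.
exists (repr q * r'); first exact: IntZ_zero_constM.
by rewrite rmorphM /= reprK.
Qed.

Lemma zero_constD (q r : IntR k X) : q \in @zero_const k X ->
  r \in @zero_const k X -> q + r \in @zero_const k X.
Proof.
case: k q r => [|p p_pr] q r; first exact: IntZ_zero_constD.
move=> /asboolP[q' q'0 <-] /asboolP[r' r'0 <-]; apply/asboolP.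
by exists (q' + r'); [exact: IntZ_zero_constD | rewrite rmorphD].
Qed.

Lemma zero_const0 : 0 \in @zero_const k X.
Proof.
have Z0 : 0 \in @IntZ_zero_const X by rewrite unfold_in /= mcoeff0.
case: k => [|p p_pr]; first exact: Z0.
by apply/asboolP; exists 0 => //; rewrite rmorph0.
Qed.

Lemma zero_const_closed : submod_closed (@zero_const k X).
Proof.
split=> [|a q r q0 r0]; first exact: zero_const0.
by apply: zero_constD => //; rewrite -mulr_algl zero_constM.
Qed.

HB.instance Definition _ := GRing.isSubmodClosed.Build
  (coef_ring k) (IntR k X) (@zero_const k X) zero_const_closed.

Lemma IntR_var_zero_const x : IntR_var k x \in @zero_const k X.
Proof.
have Z0 : IntZ_var x \in @IntZ_zero_const X.
  by rewrite unfold_in /= mcoeffU cm1_eq1.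
by case: k => [|p p_pr]; [exact: Z0 | apply/asboolP; exists (IntZ_var x)].
Qed.

Record maug := MkMaug { maug_val :> IntR k X; _ : maug_val \in @zero_const k X }.

HB.instance Definition _ := [isSub for maug_val].
HB.instance Definition _ := [Choice of maug by <:].
HB.instance Definition _ := [SubChoice_isSubLmodule of maug by <:].

Definition maug_mul (q r : maug) : maug :=
  MkMaug (zero_constM (maug_val q) (valP r)).

Definition maug_var (x : X) : maug := MkMaug (IntR_var_zero_const x).

End AugmentationIdeal.

Section LmodQuotient.
Variables (R : pzRingType) (V : lmodType R) (G : V -> Prop).

Lemma lspan_submod_closed : submod_closed (lspan G).
Proof.
have [[S0 SD] SZ] := lspan_closed G.
by split=> // a u v Su Sv; apply: SD => //; apply: SZ.
Qed.

HB.instance Definition _ :=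
  GRing.isSubmodClosed.Build R V (lspan G) lspan_submod_closed.

Definition lquot := Quotient.quot (lspan G : zmodClosed V).

HB.instance Definition _ := GRing.Zmodule.on lquot.

Definition lquot_scale (a : R) (u : lquot) : lquot := \pi_lquot (a *: repr u).

Lemma lquot_scale_pi a v : lquot_scale a (\pi_lquot v) = \pi_lquot (a *: v).
Proof.
apply/eqP; rewrite /lquot_scale -Quotient.idealrBE -scalerBr.
have [_ SZ] := lspan_closed G; apply: SZ.
by rewrite Quotient.idealrBE reprK.
Qed.

Lemma lquotK (u : lquot) : \pi_lquot (repr u) = u.
Proof. exact: reprK. Qed.

Lemma lquot_scaleA a b u : lquot_scale a (lquot_scale b u) = lquot_scale (a * b) u.
Proof. by rewrite -[u]lquotK !lquot_scale_pi scalerA. Qed.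
Lemma lquot_scale1 : left_id 1 lquot_scale.
Proof. by move=> u; rewrite -[u]lquotK lquot_scale_pi scale1r. Qed.
Lemma lquot_scaleDr : right_distributive lquot_scale +%R.
Proof.
move=> a u v; rewrite -[u]lquotK -[v]lquotK.
rewrite -(raddfD (\pi_lquot : {additive V -> lquot})) !lquot_scale_pi.
by rewrite scalerDr raddfD.
Qed.
Lemma lquot_scaleDl u : {morph lquot_scale^~ u : a b / a + b}.
Proof.
by move=> a b; rewrite -[u]lquotK !lquot_scale_pi scalerDl raddfD.
Qed.

HB.instance Definition _ := GRing.Zmodule_isLmodule.Build R lquot
  lquot_scaleA lquot_scale1 lquot_scaleDr lquot_scaleDl.

End LmodQuotient.

Section TensorPower.
Variables (R : comNzRingType) (U : lmodType R).

Definition tset n (t : n.-tuple U) (i : 'I_n) (u : U) : n.-tuple U :=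
  [tuple if j == i then u else tnth t j | j < n].

(* tpow n is the n-th tensor power of U: the free module on U^n modulo the
   multilinearity relations; tens t is the class of u_1 (x) ... (x) u_n. *)
Definition tens_rel n (v : {malg R[n.-tuple U]}) : Prop :=
  exists t i (r : R) u u', v =
    << tset t i (r *: u + u') >> - r *: << tset t i u >> - << tset t i u' >>.

Definition tpow (n : nat) : lmodType R := lquot (@tens_rel n).

Definition tens n (t : n.-tuple U) : tpow n := \pi_(lquot _) << t >>.

(* The linear map induced by a multilinear f, computed on a representative; see
   tlift_spec for the independence of the choice. *)
Definition tlift n (W : lmodType R) (f : n.-tuple U -> W) (u : tpow n) : W :=
  let v : {malg R[n.-tuple U]} := repr u in \sum_(t <- msupp v) v@_t *: f t.

Definition multilinear n (W : lmodType R) (f : n.-tuple U -> W) : Prop :=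
  forall t i, linear (fun u => f (tset t i u)).

Lemma tlift_spec n (W : lmodType R) (f : n.-tuple U -> W) : multilinear f ->
  linear (tlift f) /\ forall t, tlift f (tens t) = f t.
Proof.
move=> f_lin; pose ext (v : {malg R[n.-tuple U]}) := \sum_(t <- msupp v) v@_t *: f t.
have extE v (D : {fset n.-tuple U}) : (msupp v `<=` D)%fset ->
    ext v = \sum_(t <- D) v@_t *: f t.
  by move=> sub; apply: big_fset_incl => // t _ /mcoeff_outdom->; rewrite scale0r.
have ext_lin : linear ext.
  move=> r u v; pose D := (msupp u `|` msupp v `|` msupp (r *: u + v))%fset.
  rewrite !(extE _ D) ?scaler_sumr -?big_split /=.
  - by apply: eq_bigr => t _; rewrite mcoeffD mcoeffZ scalerDl scalerA.
  - by rewrite /D fsubsetU // fsubsetUr.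
  - by rewrite /D fsubsetU // fsubsetUl.
  - by rewrite /D fsubsetUr.
have ext0 : ext 0 = 0 by rewrite /ext msupp0 big_seq_fset0.
have extZ r u : ext (r *: u) = r *: ext u by rewrite -[r *: u]addr0 ext_lin ext0 addr0.
have extD u v : ext (u + v) = ext u + ext v by rewrite -{1}[u]scale1r ext_lin scale1r.
have extN u : ext (- u) = - ext u by rewrite -(scaleN1r u) extZ scaleN1r.
have extU t : ext << t >> = f t.
  by rewrite /ext msuppU oner_eq0 big_seq_fset1 mcoeffUU scale1r.
have ext_rel v : v \in lspan (@tens_rel n) -> ext v = 0.
  move=> /asboolP[s [Gs ->]]; elim: s Gs => [|[r g] s IHs] Gs.
    by rewrite big_nil.
  rewrite big_cons extD extZ IHs; last first.
    by move=> rg srg; apply: Gs; rewrite inE srg orbT.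
  have [t [i [a [u [u' /= ->]]]]] := Gs _ (mem_head _ _).
  by rewrite !extD !extN extZ !extU f_lin addrAC addrK subrr scaler0 addr0.
have ext_pi v : tlift f (\pi_(lquot (@tens_rel n)) v) = ext v.
  apply/eqP; rewrite -subr_eq0 -extN -extD; apply/eqP/ext_rel.
  by rewrite Quotient.idealrBE; apply/eqP/reprK.
split=> [r u v|t]; last by rewrite ext_pi.
rewrite -[u in LHS]lquotK -[v in LHS]lquotK [_ *: _]lquot_scale_pi.
by rewrite -(raddfD (\pi_(lquot (@tens_rel n)) : {additive _ -> _})) ext_pi ext_lin.
Qed.

End TensorPower.

Section CupOne.
Variable R : comNzRingType.

(* cup21 and circ are total functions, but they are only meaningful (and only
   constrained below) on the span decomp = D^2(A) of the products of elements of
   degree 1. *)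
Record cupone_alg := CupOneAlg {
  gr :> nat -> lmodType R;
  gr1 : gr 0;
  cup : forall i j, gr i -> gr j -> gr (i + j);
  cup1 : gr 1 -> gr 1 -> gr 1;
  cup21 : gr 2 -> gr 1 -> gr 2;
  circ : gr 2 -> gr 2 -> gr 2
}.

Definition gcast (A : cupone_alg) m n (e : m = n) (x : A m) : A n :=
  ecast i (A i) e x.

Definition degree1_map (A : cupone_alg) := forall n, A n -> A n.+1.

Variables (A : cupone_alg) (d : degree1_map A).

Definition decomp : {pred A 2} :=
  lspan (fun w : A 2 => exists a b : A 1, w = cup a b).

Definition is_graded_algebra : Prop :=
  [/\ forall i j (b : A j), linear (fun a : A i => cup a b),
      forall i j (a : A i), linear (fun b : A j => cup a b),
      forall i j l (a : A i) (b : A j) (c : A l),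
        gcast (addnA i j l) (cup a (cup b c)) = cup (cup a b) c,
      forall i (a : A i), cup (gr1 A) a = a
    & forall i (a : A i), gcast (addn0 i) (cup a (gr1 A)) = a].

Definition graded_leibniz : Prop := forall i j (a : A i) (b : A j),
  d (cup a b) =
    cup (d a) b + (-1) ^+ i *: gcast (addnS i j) (cup a (d b)).

Definition cup1_d_formula (a b : A 1) : Prop :=
  d (cup1 a b) =
    - cup a b - cup b a + cup21 (d a) b + cup21 (d b) a - circ (d a) (d b).

Definition is_dga : Prop :=
  [/\ is_graded_algebra, forall n, linear (@d n),
      forall n (a : A n), d (d a) = 0 & graded_leibniz].

Definition comm_algebra (V : lmodType R) (e : V) (mul : V -> V -> V) : Prop :=
  [/\ commutative mul, associative mul, left_id e mul
    & forall v, linear (mul v)].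

(* R (+) A^1 with multiplication cup1 on A^1. *)
Definition unitized := (R^o * A 1)%type.
HB.instance Definition _ := GRing.Lmodule.on unitized.
Definition uone : unitized := (1, 0).
Definition umul (x y : unitized) : unitized :=
  (x.1 * y.1, x.1 *: y.2 + y.1 *: x.2 + cup1 x.2 y.2).

Definition cupone_ops_linear : Prop :=
  [/\ forall b : A 1, linear (fun a => cup1 a b),
      forall a : A 1, linear (fun b => cup1 a b),
      forall r v w (b : A 1), v \in decomp -> w \in decomp ->
        cup21 (r *: v + w) b = r *: cup21 v b + cup21 w b
    & forall w, w \in decomp -> linear (fun b => cup21 w b)].

Definition circ_ops_linear : Prop :=
  [/\ forall v w, v \in decomp -> w \in decomp -> circ v w \in decomp,
      forall r u v w, u \in decomp -> v \in decomp -> w \in decomp ->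
        circ (r *: u + v) w = r *: circ u w + circ v w
    & forall r u v w, u \in decomp -> v \in decomp -> w \in decomp ->
        circ w (r *: u + v) = r *: circ w u + circ w v].

Definition cupone_axioms : Prop :=
  [/\ comm_algebra uone umul,
      forall a b c : A 1,
        cup21 (cup a b) c = cup a (cup1 b c) + cup (cup1 a c) b,
      forall u v w z : A 1,
        circ (cup u v) (cup w z) = cup (cup1 u w) (cup1 v z),
      forall (a : A 1) (c : A 0), cup1 a (d c) = cup a c - cup c a
    & forall a b : A 1, d a \in decomp -> d b \in decomp -> cup1_d_formula a b].

Definition is_cupone_dga : Prop :=
  [/\ is_dga, cupone_ops_linear, circ_ops_linear & cupone_axioms].

End CupOne.

Section Binomial.
Variable k : coef.
Local Notation R := (coef_ring k).

Definition falling (V : lmodType R) (e : V) (mul : V -> V -> V) (a : V) (n : nat) : V :=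
  \big[mul/e]_(i < n) (a - e *+ i).

Definition binomial_algebra (V : lmodType R) (e : V) (mul : V -> V -> V) : Prop :=
  comm_algebra e mul /\
  match k with
  | CoefZ =>
      (forall (a : V) n, (0 < n)%N -> a *+ n = 0 -> a = 0) /\
      (forall (a : V) n, (0 < n)%N -> exists z, z *+ n`! = falling e mul a n)
  | CoefF p _ => forall a : V, \big[mul/e]_(i < p) a = a
  end.

Definition zeta_range (n : nat) : bool :=
  (0 < n)%N && match k with CoefZ => true | CoefF p _ => (n < p)%N end.

(* The unique solution z of n! z = a (a - 1) .. (a - n + 1) in a binomial algebra
   (for n in zeta_range). *)
Definition zeta (V : lmodType R) (e : V) (mul : V -> V -> V) (n : nat) (a : V) : V :=
  xget 0 [set z | z *+ n`! = falling e mul a n].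

Definition zeta1 (A : cupone_alg R) (n : nat) (a : A 1) : A 1 :=
  (zeta (uone A) (@umul R A) n (0, a)).2.

Definition is_binomial_cupone_dga (A : cupone_alg R) (d : degree1_map A) : Prop :=
  [/\ is_cupone_dga d,
      binomial_algebra (gr1 A) (fun a b : A 0 => cup a b : A 0)
    & binomial_algebra (uone A) (@umul R A)].

Definition is_morphism (A B : cupone_alg R) (dA : degree1_map A)
    (dB : degree1_map B) (f : forall n, A n -> B n) : Prop :=
  [/\ (forall n, linear (@f n)) /\ f 0 (gr1 A) = gr1 B,
      forall i j (a : A i) (b : A j), f _ (cup a b) = cup (f _ a) (f _ b),
      forall n (a : A n), f _ (dA _ a) = dB _ (f _ a),
      forall a b : A 1, f _ (cup1 a b) = cup1 (f _ a) (f _ b)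
    & forall n (a : A 1), zeta_range n -> f _ (zeta1 n a) = zeta1 n (f _ a)].

End Binomial.

Section BarCochains.
Variables (R : comNzRingType) (M : Type) (op : M -> M -> M).

Definition simplex (n : nat) := 'I_n -> M.

(* The i-th face of (a_1, .., a_{n+1}): a_1 is dropped for i = 0, a_{n+1} for
   i = n + 1, and a_i, a_{i+1} are replaced by their product otherwise. *)
Definition bar_face n (i : 'I_n.+2) (s : simplex n.+1) : simplex n := fun j =>
  let a := s (widen_ord (leqnSn n) j) in
  let a' := s (lift ord0 j) in
  if (j.+1 < i)%N then a else if j.+1 == i :> nat then op a a' else a'.

Definition cochain (n : nat) : lmodType R := simplex n -> R^o.

Definition bar_d n (f : cochain n) : cochain n.+1 := fun s =>
  \sum_(i < n.+2) (-1) ^+ i * f (bar_face i s).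

Definition cochain_cup i j (f : cochain i) (g : cochain j) : cochain (i + j) :=
  fun s => f (fun l => s (lshift j l)) * g (fun l => s (rshift i l)).

Definition cochain_cup1 (f g : cochain 1) : cochain 1 := fun s => f s * g s.

(* On w = a U b this is a U (b U_1 c) + (a U_1 c) U b, and it is linear in w. *)
Definition cochain_cup21 (w : cochain 2) (c : cochain 1) : cochain 2 := fun s =>
  w s * (c (fun=> s ord0) + c (fun=> s ord_max)).

Definition cochain_circ (v w : cochain 2) : cochain 2 := fun s => v s * w s.

Definition bar_cochains : cupone_alg R :=
  @CupOneAlg R cochain (fun=> 1) cochain_cup cochain_cup1 cochain_cup21 cochain_circ.

End BarCochains.

Section TensorAlgebra.
Variables (k : coef) (X : choiceType).
Local Notation R := (coef_ring k).
Local Notation m := (maug k X).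
Local Notation T := (tpow m).

Definition iota1 (q : m) : T 1 := tens [tuple q].
(* The inverse of the isomorphism iota1 : m -> T^1. *)
Definition deg1 (u : T 1) : m := tlift (fun t => thead t) u.

Definition tens2 (q r : m) : T 2 := tens [tuple q; r].
Definition tlift2 (W : lmodType R) (f : m -> m -> W) : T 2 -> W :=
  tlift (fun t => f (tnth t ord0) (tnth t ord_max)).

Definition tcup i j (u : T i) (v : T j) : T (i + j) :=
  tlift (fun s => tlift (fun t => tens (cat_tuple s t)) v) u.

Definition tcup1 (u v : T 1) : T 1 := iota1 (maug_mul (deg1 u) (deg1 v)).

Definition tcup21 (w : T 2) (u : T 1) : T 2 :=
  tlift2 (fun a b => tens2 (maug_mul a (deg1 u)) b + tens2 a (maug_mul b (deg1 u))) w.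

Definition tcirc (v w : T 2) : T 2 :=
  tlift2 (fun a1 a2 =>
    tlift2 (fun b1 b2 => tens2 (maug_mul a1 b1) (maug_mul a2 b2)) w) v.

Definition tensor_alg : cupone_alg R :=
  @CupOneAlg R T (tens [tuple]) tcup tcup1 tcup21 tcirc.

Variable tau : X -> T 2.

Definition is_d_tau (d : degree1_map tensor_alg) : Prop :=
  [/\ forall n, linear (@d n),
      forall x, d _ (iota1 (maug_var k x)) = tau x,
      graded_leibniz d
    & forall a b, cup1_d_formula d a b].

(* Definite description of the d satisfying is_d_tau; the default 0 is never used,
   since such a d exists and is unique. *)
Definition d_tau : degree1_map tensor_alg :=
  if pselect (exists d, is_d_tau d) is left ex then sval (cid ex) else fun _ _ => 0.

Definition mu (a a' : X -> R) : X -> R := fun x =>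
  a x + a' x -
    tlift2 (fun q r => IntR_eval (val q) a * IntR_eval (val r) a' : R^o) (tau x).

Definition admissible : Prop := associative mu.

Definition bar_alg : cupone_alg R := bar_cochains R (X -> R).

Definition d_bar : degree1_map bar_alg := bar_d mu.

Definition extends_eval (psi : forall n, tensor_alg n -> bar_alg n) : Prop :=
  forall (q : m) (s : simplex (X -> R) 1),
    psi 1 (iota1 q) s = IntR_eval (val q) (s ord0).

End TensorAlgebra.

(* Main.v *)
Require Import Defs.
From HB Require Import structures.
From mathcomp Require Import all_boot all_order all_algebra.
From mathcomp Require Import finmap zify ring.
From mathcomp Require Import boolp classical_sets functions.
From mathcomp.multinomials Require Import monalg.

Set Implicit Arguments.
Unset Strict Implicit.
Unset Printing Implicit Defensive.

Import GRing.Theory Num.Theory.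
Local Open Scope ring_scope.
Local Open Scope quotient_scope.

(** For q in the augmentation ideal m let psi q be the function a |-> q(a), and
    let psi (q_1 (x) .. (x) q_n) (a_1, .., a_n) = q_1(a_1) .. q_n(a_n).  Newton
    interpolation at non-negative integer points, whose basis consists of products
    of binomial coefficients, writes every q of a given finite list as a sum of the
    terms q(a_l) e_l with fixed points a_l and fixed e_l in m.  Applied to each
    tensor factor it shows that psi is injective in all degrees; it also shows that
    Int(R^X) is generated by X if division by nonzero scalars is allowed, and that
    the functions sum_i e_i(a) e'_i(a') form a subring of the functions on M x M
    that is closed under such divisions.  That subring contains the coordinates of
    mu_tau, hence all q o mu_tau, so the bar coboundary of psi q lies in the image
    of psi.  By the Leibniz rule the image of psi is therefore a subcomplex of the
    bar cochains; d_tau is the coboundary transported along psi, and every identity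
    for it, d_tau^2 = 0 included, is pulled back from the bar complex. *)

Lemma linear_sumZ (R : pzRingType) (V W : lmodType R) (g : V -> W) (I : finType)
    (c : I -> R) (e : I -> V) :
  linear g -> g (\sum_i c i *: e i) = \sum_i c i *: g (e i).
Proof.
move=> g_lin; pose h : {linear V -> W} := HB.pack g (GRing.isLinear.Build _ _ _ _ g g_lin).
by rewrite -[g]/(h : V -> W) linear_sum; apply: eq_bigr => i _; apply: linearZ.
Qed.

Section Span.
Variables (R : pzRingType) (V : lmodType R) (G : V -> Prop).

Lemma mem_lspan v : G v -> v \in lspan G.
Proof.
move=> Gv; apply/asboolP; exists [:: (1, v)].
by rewrite big_seq1 scale1r; split=> // rg; rewrite inE => /eqP->.
Qed.

Lemma lspan_ind (P : V -> Prop) :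
    P 0 -> (forall r u v, G u -> v \in lspan G -> P v -> P (r *: u + v)) ->
  forall v, v \in lspan G -> P v.
Proof.
move=> P0 PG v /asboolP[s [Gs ->]]; elim: s Gs => [|[r u] s IHs] Gs.
  by rewrite big_nil.
have Gu := Gs _ (mem_head _ _); have {}Gs ru : ru \in s -> G ru.2.
  by move=> s_ru; apply: Gs; rewrite inE s_ru orbT.
rewrite big_cons; apply: PG; [exact: Gu | | exact: IHs].
by apply/asboolP; exists s.
Qed.

End Span.

Lemma malgUZ (K : choiceType) (R : nzRingType) (c : R) (k : K) :
  << c *g k >> = c *: << k >> :> {malg R[K]}.
Proof. by apply/malgP => k'; rewrite mcoeffZ !mcoeffU mulrnAr mulr1. Qed.

Lemma scale_regularE (R : pzRingType) (r : R) (a : R^o) : r *: a = r * a :> R.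
Proof. by []. Qed.

Section SeparatingCharacters.
Variables (R : comNzRingType) (V : lmodType R) (e : V) (mul : V -> V -> V).
Variables (I : Type) (chi : I -> {scalar V}).
Hypothesis chi1 : forall i, chi i e = 1.
Hypothesis chiM : forall i, {morph chi i : u v / mul u v >-> u * v}.
Hypothesis chi_inj : forall u v, (forall i, chi i u = chi i v) -> u = v.

Lemma separating_characters_comm_algebra : comm_algebra e mul.
Proof.
split=> [u v|u v w|u|w c u v]; apply: chi_inj => i.
- by rewrite !chiM mulrC.
- by rewrite !chiM mulrA.
- by rewrite chiM chi1 mul1r.
- by rewrite chiM !linearP /= !chiM; ring.
Qed.

End SeparatingCharacters.

Section CircDecomp.
Variables (R : comNzRingType) (A : cupone_alg R).
Local Notation D := (@decomp R A).
Hypothesis circ_linl : forall r u v w, u \in D -> v \in D -> w \in D ->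
  circ (r *: u + v) w = r *: circ u w + circ v w.
Hypothesis circ_linr : forall r u v w, u \in D -> v \in D -> w \in D ->
  circ w (r *: u + v) = r *: circ w u + circ w v.
Hypothesis circ_cup : forall u v w z : A 1,
  circ (cup u v) (cup w z) = cup (cup1 u w) (cup1 v z).

Lemma circ_decomp v w : v \in D -> w \in D -> circ v w \in D.
Proof.
have D0 : 0 \in D by apply: rpred0.
have Dcup (a b : A 1) : cup a b \in D by apply: mem_lspan; exists a, b.
move=> Dv Dw; elim/lspan_ind: v / Dv => [|r _ v [a [b ->]] Dv IHv].
  have := circ_linl (-1) D0 D0 Dw.
  by rewrite scaler0 addr0 scaleN1r addNr => ->.
rewrite circ_linl //; apply: rpredD IHv; apply: rpredZ.
elim/lspan_ind: w / Dw => [|r' _ w [a' [b' ->]] Dw IHw].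
  have := circ_linr (-1) D0 D0 (Dcup a b).
  by rewrite scaler0 addr0 scaleN1r addNr => ->.
by rewrite circ_linr //; apply: rpredD IHw; apply: rpredZ; rewrite circ_cup.
Qed.

End CircDecomp.

(** * The bar complex *)

Section BarComplex.
Variables (R : comNzRingType) (M : Type) (op : M -> M -> M).

Local Notation C := (cochain R M).
Local Notation A := (bar_cochains R M).

Lemma cochainDE n (f g : C n) s : (f + g) s = f s + g s :> R.
Proof. by []. Qed.

Lemma cochainNE n (f : C n) s : (- f) s = - f s :> R.
Proof. by []. Qed.

Lemma cochainZE n r (f : C n) s : (r *: f) s = r * f s :> R.
Proof. by []. Qed.

Definition cochain_at n (s : simplex M n) (f : C n) : R := f s.

Lemma cochain_at_scalar n (s : simplex M n) : scalar (cochain_at s).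
Proof. by []. Qed.

HB.instance Definition _ n (s : simplex M n) :=
  GRing.isLinear.Build R (C n) R *%R (cochain_at s) (cochain_at_scalar s).

Lemma bar_cup1E (f g : A 1) s : cup1 f g s = f s * g s.
Proof. by []. Qed.

Lemma bar_cup21E (w : A 2) (f : A 1) s :
  cup21 w f s = w s * (f (fun=> s ord0) + f (fun=> s ord_max)).
Proof. by []. Qed.

Lemma bar_circE (v w : A 2) s : circ v w s = v s * w s.
Proof. by []. Qed.

Definition cochainE :=
  (cochainDE, cochainNE, cochainZE, bar_cup1E, bar_cup21E, bar_circE).

(* Simplices are handled as restrictions of sequences indexed by [nat], which
   removes all ordinal arithmetic from the face identities. *)
Definition seq_simplex n (s : nat -> M) : simplex M n := fun i => s i.
Arguments seq_simplex n s i : clear implicits.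

Lemma seq_simplex_surj n (s : simplex M n.+1) : exists s', s = seq_simplex n.+1 s'.
Proof.
by exists (fun l => s (inord l)); apply: funext => i; rewrite /seq_simplex inord_val.
Qed.

Lemma cochain_seqP n (f g : C n.+1) :
  (forall s, f (seq_simplex n.+1 s) = g (seq_simplex n.+1 s)) -> f = g.
Proof. by move=> fg; apply: funext => s; have [s' ->] := seq_simplex_surj s. Qed.

Lemma simplex0_eq (s s' : simplex M 0) : s = s'.
Proof. by apply: funext => -[]. Qed.

Definition seq_face (i : nat) (s : nat -> M) : nat -> M := fun l =>
  if (l.+1 < i)%N then s l else if l.+1 == i then op (s l) (s l.+1) else s l.+1.

Definition seq_shift (i : nat) (s : nat -> M) : nat -> M := fun l => s (i + l)%N.

Lemma bar_d_seqE n (f : C n) s :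
  bar_d op f (seq_simplex n.+1 s)
    = \sum_(0 <= i < n.+2) (-1) ^+ i * f (seq_simplex n (seq_face i s)).
Proof. by rewrite big_mkord. Qed.

Lemma cup_seqE i j (f : A i) (g : A j) s :
  cup f g (seq_simplex _ s)
    = f (seq_simplex i s) * g (seq_simplex j (seq_shift i s)).
Proof. by []. Qed.

Lemma gcast_seqE m n (e : m = n) (f : C m) s :
  gcast (A := A) e f (seq_simplex n s) = f (seq_simplex m s).
Proof. by case: n / e. Qed.

Lemma seq_face_face : associative op ->
  forall i j s, (i <= j)%N -> seq_face j (seq_face i s) = seq_face i (seq_face j.+1 s).
Proof.
move=> opA i j s le_ij; apply: funext => l; rewrite /seq_face.
by repeat (case: ifP => ?); try lia; rewrite ?opA.
Qed.

Lemma alternating_double_sum n (G : nat -> nat -> R) :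
    (forall i j, (i <= j)%N -> G i j = G j.+1 i) ->
  \sum_(0 <= i < n.+1) (-1) ^+ i * (\sum_(0 <= j < n) (-1) ^+ j * G i j) = 0.
Proof.
move=> G_sym; elim: n => [|n IHn]; first by rewrite big_nat1 big_geq ?mulr0.
rewrite big_nat_recr //=.
under eq_bigr => i _ do rewrite big_nat_recr //= mulrDr.
rewrite big_split /= IHn add0r mulr_sumr -big_split big_nat big1 //= => i lt_in.
by rewrite G_sym // exprS; ring.
Qed.

Lemma bar_d_squared n (f : C n) : associative op -> bar_d op (bar_d op f) = 0.
Proof.
move=> opA; apply: cochain_seqP => s; rewrite bar_d_seqE.
under eq_bigr => i _ do rewrite bar_d_seqE.
apply: (@alternating_double_sum n.+2
  (fun i j => f (seq_simplex n (seq_face j (seq_face i s))))) => i j le_ij.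
by rewrite seq_face_face.
Qed.

Lemma bar_d_linear n : linear (@bar_d R M op n).
Proof.
move=> r f g; apply: funext => s; rewrite !cochainE /bar_d mulr_sumr -big_split.
by apply: eq_bigr => i _; rewrite !cochainE /=; ring.
Qed.

HB.instance Definition _ n :=
  GRing.isLinear.Build R (C n) (C n.+1) *:%R (@bar_d R M op n) (@bar_d_linear n).

Section Leibniz.
Variables (i j : nat) (f : A i) (g : A j).

Lemma cup_face_front l s : (l <= i)%N ->
  cup f g (seq_simplex (i + j) (seq_face l s))
    = f (seq_simplex i (seq_face l s)) * g (seq_simplex j (seq_shift i.+1 s)).
Proof.
move=> le_li; rewrite cup_seqE; congr (_ * g _); apply: funext => q.
by rewrite /seq_simplex /seq_face /seq_shift ifF ?ifF ?addSn //; lia.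
Qed.

Lemma cup_face_back l s :
  cup f g (seq_simplex (i + j) (seq_face (i.+1 + l) s))
    = f (seq_simplex i s) * g (seq_simplex j (seq_face l.+1 (seq_shift i s))).
Proof.
rewrite cup_seqE; congr (f _ * g _); apply: funext => q.
  by rewrite /seq_simplex /seq_face ifT //; have := ltn_ord q; lia.
rewrite /seq_simplex /seq_face /seq_shift -addnS addSnnS ltn_add2l eqn_add2l.
by rewrite addnS.
Qed.

Lemma seq_face_last s : seq_simplex i (seq_face i.+1 s) = seq_simplex i s.
Proof. by apply: funext => q; rewrite /seq_simplex /seq_face ltnS ltn_ord. Qed.

Lemma seq_face0_shift s : seq_face 0 (seq_shift i s) = seq_shift i.+1 s.
Proof. by apply: funext => q; rewrite /seq_face /seq_shift /= addSnnS. Qed.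

Lemma sum_split_faces (F : nat -> R) :
  \sum_(0 <= l < (i + j).+2) F l
    = \sum_(0 <= l < i.+1) F l + \sum_(0 <= l < j.+1) F (i.+1 + l)%N.
Proof. by rewrite -addnS -addSn !big_mkord big_split_ord. Qed.

End Leibniz.

(* The last face of the front simplex and the first face of the back one cancel;
   the remaining faces are those of the whole simplex. *)
Lemma bar_leibniz : graded_leibniz (A := A) (@bar_d R M op).
Proof.
move=> i j f g; apply: cochain_seqP => s.
rewrite !cochainE gcast_seqE !cup_seqE !bar_d_seqE sum_split_faces.
under eq_big_nat => l /andP[_ lt_li] do rewrite cup_face_front // mulrA.
under [X in _ + X]eq_bigr => l _ do rewrite cup_face_back.
rewrite -mulr_suml [in RHS]big_nat_recr // [X in _ = _ + _ * (_ * X)]big_nat_recl //=.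
rewrite seq_face_last seq_face0_shift.
set back := \sum_(0 <= l < j.+1) (-1) ^+ l.+1 * _.
under [X in _ + X = _]eq_bigr => l _ do rewrite addSnnS exprD mulrACA.
by rewrite -mulr_sumr -/back exprS; ring.
Qed.

Lemma seq_simplex1 (s : nat -> M) : seq_simplex 1 s = fun=> s 0.
Proof. by apply: funext => i; rewrite /seq_simplex ord1. Qed.

Lemma cup11E (f g : A 1) (s : simplex M 2) :
  cup f g s = f (fun=> s ord0) * g (fun=> s ord_max).
Proof.
have [s' ->] := seq_simplex_surj s.
by rewrite cup_seqE !seq_simplex1 /seq_shift addn0.
Qed.

Lemma bar_d1E (f : C 1) (s : simplex M 2) :
  bar_d op f s
    = f (fun=> s ord0) + f (fun=> s ord_max) - f (fun=> op (s ord0) (s ord_max)).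
Proof.
have [s' ->] := seq_simplex_surj s; rewrite bar_d_seqE.
rewrite !big_nat_recr //= big_geq // add0r !seq_simplex1 /seq_face /seq_simplex /=.
by rewrite expr0 expr1 sqrrN expr1n; ring.
Qed.

Lemma bar_d0E (f : C 0) : bar_d op f = 0.
Proof.
apply: cochain_seqP => s; rewrite bar_d_seqE.
rewrite !big_nat_recr //= big_geq // add0r expr0 expr1 mulN1r mul1r.
by rewrite (simplex0_eq (seq_simplex 0 _) (seq_simplex 0 (seq_face 0 s))) subrr.
Qed.

Lemma gcast_barE i j (e : i = j) (f : C i) s :
  gcast (A := A) e f s = f (s \o cast_ord e).
Proof.
by case: j / e s => s; congr f; apply: funext => l; congr s; apply: val_inj.
Qed.

Lemma bar_graded_algebra : is_graded_algebra A.
Proof.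
split=> [i j g r f f'|i j f r g g'|i j l f g h|i f|i f]; apply: funext => s.
- by rewrite /cup /= /cochain_cup !cochainE mulrDl mulrA.
- by rewrite /cup /= /cochain_cup !cochainE mulrDr mulrCA.
- rewrite gcast_barE /cup /= /cochain_cup mulrA.
  by congr (f _ * g _ * h _); apply: funext => q; congr s; apply: val_inj => //=; rewrite addnA.
- rewrite /cup /= /cochain_cup mul1r.
  by congr f; apply: funext => q; congr s; apply: val_inj.
- rewrite gcast_barE /cup /= /cochain_cup mulr1.
  by congr f; apply: funext => q; congr s; apply: val_inj.
Qed.

Lemma bar_cup1_d (f g : A 1) : cup1_d_formula (@bar_d R M op : degree1_map A) f g.
Proof. by apply: funext => s; rewrite !(cochainE, bar_d1E, cup11E); ring. Qed.

Lemma bar_cupone_ops_linear : cupone_ops_linear A.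
Proof.
by split=> [g r f f'|f r g g'|r v w f _ _|w _ r f g]; apply: funext => s;
  rewrite !cochainE; ring.
Qed.

Lemma bar_circ_cup (u v w z : A 1) :
  circ (cup u v : A 2) (cup w z) = cup (cup1 u w) (cup1 v z).
Proof. by apply: funext => s; rewrite !(cochainE, cup11E); ring. Qed.

Lemma bar_circ_ops_linear : circ_ops_linear A.
Proof.
have circ_linl r (u v w : A 2) : circ (r *: u + v) w = r *: circ u w + circ v w.
  by apply: funext => s; rewrite !cochainE; ring.
have circ_linr r (u v w : A 2) : circ w (r *: u + v) = r *: circ w u + circ w v.
  by apply: funext => s; rewrite !cochainE; ring.
by split=> //; apply: circ_decomp => // *; apply: bar_circ_cup.
Qed.

Definition bar_character (i : option (simplex M 1)) (x : unitized A) : R :=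
  if i is Some s then x.1 + x.2 s else x.1.

Lemma bar_character_scalar i : scalar (bar_character i).
Proof. by case: i => [s|] r [a f] [b g] //=; rewrite !(scale_regularE, cochainE); ring. Qed.

HB.instance Definition _ i := GRing.isLinear.Build R (unitized A) R *%R
  (bar_character i) (bar_character_scalar i).

Lemma bar_character1 i : bar_character i (uone A) = 1.
Proof. by case: i => [s|] //=; rewrite addr0. Qed.

Lemma bar_characterM i : {morph bar_character i : x y / umul x y >-> x * y}.
Proof. by case: i => [s|] [a f] [b g] //=; rewrite !cochainE /cochain_cup1; ring. Qed.

Lemma bar_character_inj x y :
  (forall i, bar_character i x = bar_character i y) -> x = y.
Proof.
case: x y => [a f] [b g] fg; have /= ab := fg None; rewrite ab; congr pair.
by apply: funext => s; have := fg (Some s); rewrite /= ab => /addrI.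
Qed.

Lemma bar_unitized_comm_algebra : comm_algebra (uone A) (@umul R A).
Proof.
exact: separating_characters_comm_algebra bar_character1 bar_characterM bar_character_inj.
Qed.

Lemma bar_is_cupone_dga :
  associative op -> is_cupone_dga (@bar_d R M op : degree1_map A).
Proof.
move=> opA; split.
- split; [exact: bar_graded_algebra | exact: bar_d_linear | | exact: bar_leibniz].
  by move=> n f; apply: bar_d_squared.
- exact: bar_cupone_ops_linear.
- exact: bar_circ_ops_linear.
split; first exact: bar_unitized_comm_algebra.
- by move=> f g h; apply: funext => s; rewrite !(cochainE, cup11E); ring.
- exact: bar_circ_cup.
- move=> f c; rewrite bar_d0E; apply: cochain_seqP => s.
  rewrite !cochainE mulr0 (cup_seqE f c) (cup_seqE c f) mulrC.
  by rewrite (simplex0_eq (seq_simplex 0 s) (seq_simplex 0 (seq_shift 1 s))) subrr.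
- by move=> f g _ _; apply: bar_cup1_d.
Qed.

End BarComplex.

(** * Binomial algebras *)

Definition ffactr (A : pzRingType) (a : A) (n : nat) : A := \prod_(i < n) (a - i%:R).

Lemma ffactr0 (A : pzRingType) (a : A) : ffactr a 0 = 1.
Proof. exact: big_ord0. Qed.

Lemma ffactrS (A : pzRingType) (a : A) n : ffactr a n.+1 = ffactr a n * (a - n%:R).
Proof. exact: big_ord_recr. Qed.

Lemma rmorph_ffactr (A B : comPzRingType) (f : {rmorphism A -> B}) a n :
  f (ffactr a n) = ffactr (f a) n.
Proof. by rewrite rmorph_prod; apply: eq_bigr => i _; rewrite rmorphB rmorph_nat. Qed.

Lemma ffactr_nat (A : comPzRingType) m n : ffactr m%:R n = (m ^_ n)%:R :> A.
Proof.
elim: n => [|n IHn]; first by rewrite ffactr0.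
rewrite ffactrS IHn ffactnSr natrM.
have [le_nm|lt_mn] := leqP n m; first by rewrite natrB.
by rewrite ffact_small ?mul0r.
Qed.

Lemma int_binomial (z : int) n : exists w : int, w *+ n`! = ffactr z n.
Proof.
case: z => m.
  by exists 'C(m, n)%:R; rewrite -[Posz m]natz ffactr_nat -bin_ffact natrM mulr_natr.
exists ((-1) ^+ n * 'C(m + n, n)%:R); rewrite -[_ *+ n`!]mulr_natr -mulrA -natrM bin_ffact.
elim: n => [|n IHn]; first by rewrite ffactr0 addn0.
rewrite ffactrS -IHn addnS ffactSS NegzE exprS natrM.
by rewrite -addSn natrD -[m.+1%:Z]natz; ring.
Qed.

Lemma prime_dvd_fact p n : prime p -> (p %| n`!)%N = (p <= n)%N.
Proof.
move=> p_pr; apply/idP/idP => [|le_pn]; last by rewrite dvdn_fact ?prime_gt0.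
elim: n => [|n IHn]; first by rewrite dvdn1 => /eqP p1; rewrite p1 in p_pr.
rewrite factS Euclid_dvdM // => /orP[/dvdn_leq-> //|/IHn]; exact: leqW.
Qed.

Lemma natr_fact_eq0_leq (A : pzSemiRingType) m n :
  (m <= n)%N -> m`!%:R = 0 :> A -> n`!%:R = 0 :> A.
Proof. by move=> le_mn m0; rewrite (fact_split le_mn) natrM m0 mul0r. Qed.

Lemma coef_mulfI k (c : coef_ring k) : c != 0 -> injective ( *%R c).
Proof. by case: k c => [|p p_pr] c; [apply: (@mulfI int) | apply: (@mulfI 'F_p)]. Qed.

Lemma natr_coefZ_neq0 n : (n%:R != 0 :> coef_ring CoefZ) = (0 < n)%N.
Proof. by rewrite lt0n -(pnatr_eq0 int). Qed.

Lemma fact_Fp_eq0 p (p_pr : prime p) n :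
  (n`!%:R == 0 :> coef_ring (CoefF p_pr)) = (p <= n)%N.
Proof. by rewrite -(prime_dvd_fact _ p_pr) (dvdn_pcharf (pchar_Fp p_pr)). Qed.

Lemma fact_coef_neq0 k n : zeta_range k n -> n`!%:R != 0 :> coef_ring k.
Proof.
case: k => [|p p_pr] /andP[_]; first by rewrite natr_coefZ_neq0 fact_gt0.
by rewrite fact_Fp_eq0 ltnNge.
Qed.

Lemma coef_binomial k n (r : coef_ring k) :
  zeta_range k n -> exists w, w *+ n`! = ffactr r n.
Proof.
move=> /fact_coef_neq0; case: k r => [|p p_pr] r fact_n0; first exact: int_binomial.
exists ((n`!%:R : 'F_p)^-1 * ffactr r n).
by rewrite -[_ *+ n`!]mulr_natl; apply: (@mulVKf 'F_p).
Qed.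

Lemma coef_binomial_fun k n : zeta_range k n ->
  exists w : coef_ring k -> coef_ring k, forall r, w r *+ n`! = ffactr r n.
Proof. by move=> n_k; have [w wE] := choice (fun r => coef_binomial r n_k); exists w. Qed.

Lemma coef_expp p (p_pr : prime p) (r : coef_ring (CoefF p_pr)) : r ^+ p = r.
Proof.
have := pFrobenius_aut_nat (pchar_Fp p_pr) r.
by rewrite pFrobenius_autE natr_Zp.
Qed.

Lemma binomial_algebraI k (V : lmodType (coef_ring k)) (e : V) (mul : V -> V -> V) :
    comm_algebra e mul ->
    (forall n, n%:R != 0 :> coef_ring k -> injective (fun u : V => u *+ n)) ->
    (forall a n, zeta_range k n -> exists z, z *+ n`! = falling e mul a n) ->
    (forall p, (forall r : coef_ring k, r ^+ p = r) -> forall a, \big[mul/e]_(i < p) a = a) ->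
  binomial_algebra e mul.
Proof.
case: k V e mul => [|p p_pr] V e mul mulC inj_mulrn fall_div frob; split=> //; last first.
  exact/frob/coef_expp.
split=> [a n n_gt0 an0|a n n_gt0]; last by apply: fall_div; rewrite /zeta_range n_gt0.
by apply: (inj_mulrn n); rewrite ?natr_coefZ_neq0 ?mul0rn.
Qed.

Lemma raddf_falling k l (V : lmodType (coef_ring k)) (W : lmodType (coef_ring l))
    (e : V) mul (e' : W) mul' (f : {additive V -> W}) :
    {morph f : u v / mul u v >-> mul' u v} -> f e = e' ->
  forall a n, f (falling e mul a n) = falling e' mul' (f a) n.
Proof.
move=> fM f1 a n; rewrite /falling (big_morph f fM f1); apply: eq_bigr => i _.
by rewrite raddfB raddfMn f1.
Qed.

Section BinomialCharacters.
Variables (k : coef) (V : lmodType (coef_ring k)) (e : V) (mul : V -> V -> V).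
Variables (I : Type) (chi : I -> {scalar V}).
Hypothesis chi1 : forall i, chi i e = 1.
Hypothesis chiM : forall i, {morph chi i : u v / mul u v >-> u * v}.
Hypothesis chi_inj : forall u v, (forall i, chi i u = chi i v) -> u = v.

Lemma separating_mulrn_inj n : n%:R != 0 :> coef_ring k -> injective (fun u : V => u *+ n).
Proof.
move=> n0 u v uv; apply: chi_inj => i; apply: (coef_mulfI n0).
by rewrite !mulr_natl -!raddfMn uv.
Qed.

Hypothesis chi_binomial : forall a n, zeta_range k n ->
  exists z, forall i, chi i z *+ n`! = ffactr (chi i a) n.

Lemma separating_falling_divisible a n :
  zeta_range k n -> exists z, z *+ n`! = falling e mul a n.
Proof.
move=> n_k; have [z zE] := chi_binomial a n_k; exists z; apply: chi_inj => i.
rewrite raddfMn zE.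
exact: esym (raddf_falling (W := (coef_ring k)^o) (chiM i) (chi1 i) a n).
Qed.

Lemma separating_binomial_algebra : binomial_algebra e mul.
Proof.
apply: binomial_algebraI separating_mulrn_inj separating_falling_divisible _.
  exact: separating_characters_comm_algebra chi1 chiM chi_inj.
move=> p expp a; apply: chi_inj => i.
by rewrite (big_morph (chi i) (chiM i) (chi1 i)) prodr_const card_ord expp.
Qed.

End BinomialCharacters.

(* The solution of n! z = a (a - 1) .. (a - n + 1) is unique in W, so any solution
   that comes from V is the image of the one selected by zeta. *)
Lemma raddf_zeta k (V W : lmodType (coef_ring k)) (e : V) mul (e' : W) mul'
    (f : {additive V -> W}) n a :
    {morph f : u v / mul u v >-> mul' u v} -> f e = e' ->
    (exists z, z *+ n`! = falling e mul a n) -> injective (fun u : W => u *+ n`!) ->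
  f (zeta e mul n a) = zeta e' mul' n (f a).
Proof.
move=> fM f1 [z zE] W_inj.
have fall_f := raddf_falling fM f1 a n.
have zetaV : zeta e mul n a *+ n`! = falling e mul a n.
  by apply: (@xgetPex _ 0 [set z | z *+ n`! = falling e mul a n]%classic); exists z.
have zetaW : zeta e' mul' n (f a) *+ n`! = falling e' mul' (f a) n.
  apply: (@xgetPex _ 0 [set z | z *+ n`! = falling e' mul' (f a) n]%classic).
  by exists (f z); rewrite /= -raddfMn zE.
by apply: W_inj; rewrite zetaW -raddfMn zetaV.
Qed.

(** * Interpolation by integer-valued polynomials *)

Definition bin_poly (k : nat) : {poly rat} := (k`!%:R)^-1 *: ffactr 'X k.

Definition newton_coef (k b : nat) : int := (('X - 1) ^+ k : {poly int})`_b.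

(* The Lagrange polynomial of the node b among 0, .., N - 1, in the Newton basis:
   expanding 'X^j = (1 + ('X - 1))^j shows that the coefficients of the powers of
   'X - 1 form the inverse of the Pascal matrix. *)
Definition lagrange_poly (N b : nat) : {poly rat} :=
  \sum_(k < N) (newton_coef k b)%:~R *: bin_poly k.

Lemma newton_coef_gt k b : (k < b)%N -> newton_coef k b = 0.
Proof. by move=> lt_kb; rewrite /newton_coef nth_default // size_exp_XsubC. Qed.

Lemma fact_rat_neq0 n : n`!%:R != 0 :> rat.
Proof. by rewrite pnatr_eq0 -lt0n fact_gt0. Qed.

Lemma horner_bin_poly k j : (bin_poly k).[j%:R] = 'C(j, k)%:R.
Proof.
rewrite /bin_poly hornerZ -/(horner_eval _ _) rmorph_ffactr /= /horner_eval hornerX.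
by rewrite ffactr_nat -bin_ffact natrM mulrC mulfK ?fact_rat_neq0.
Qed.

Lemma size_lagrange_poly N b : (size (lagrange_poly N b) <= N)%N.
Proof.
apply: leq_trans (size_sum _ _ _) _; apply/bigmax_leqP => k _.
do 2!apply: leq_trans (size_scale_leq _ _) _.
rewrite /ffactr; under eq_bigr => i _ do rewrite -polyC_natr.
by rewrite size_prod_XsubC /index_enum -enumT size_enum_ord.
Qed.

Lemma horner_lagrange_poly N b j :
  (j < N)%N -> (lagrange_poly N b).[j%:R] = (b == j)%:R.
Proof.
move=> lt_jN; rewrite /lagrange_poly horner_sum.
transitivity ((\sum_(k < j.+1) newton_coef k b *+ 'C(j, k))%:~R : rat).
  rewrite rmorph_sum (big_ord_widen N (fun k => (newton_coef k b *+ 'C(j, k))%:~R)) //.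
  rewrite [RHS]big_mkcond; apply: eq_bigr => k _.
  rewrite hornerZ horner_bin_poly mulr_natr -rmorphMn.
  by case: ltnP => // lt_jk; rewrite bin_small.
have := exprDn (1 : {poly int}) ('X - 1) j; rewrite addrCA subrr addr0.
move=> /(congr1 (coefp b)); rewrite /= coefXn coef_sum => binE.
rewrite -[RHS](rmorph_nat (intr : int -> rat)) binE; congr (_%:~R).
by apply: eq_bigr => k _; rewrite expr1n mul1r coefMn.
Qed.

Lemma eq_poly_nat N (p q : {poly rat}) :
    (size p <= N)%N -> (size q <= N)%N ->
    (forall j, (j < N)%N -> p.[j%:R] = q.[j%:R]) ->
  p = q.
Proof.
case: N => [|N] sz_p sz_q pq.
  by move: sz_p sz_q; rewrite !leqn0 !size_poly_eq0 => /eqP-> /eqP->.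
have nat_inj : injective (fun i : nat => i%:R : rat).
  by move=> i j /eqP; rewrite eqr_nat => /eqP.
rewrite (lagrange_gen (ltn0Sn N) nat_inj sz_p) (lagrange_gen (ltn0Sn N) nat_inj sz_q).
by apply: eq_bigr => i _; rewrite pq.
Qed.

Lemma lagrange_poly_interp N (p : {poly rat}) :
  (size p <= N)%N -> p = \sum_(b < N) p.[b%:R] *: lagrange_poly N b.
Proof.
move=> sz_p; apply: (eq_poly_nat sz_p) => [|j lt_jN].
  apply: leq_trans (size_sum _ _ _) _; apply/bigmax_leqP => b _.
  exact: leq_trans (size_scale_leq _ _) (size_lagrange_poly _ _).
rewrite horner_sum (bigD1 (Ordinal lt_jN)) //= big1 ?addr0 => [|b ne_bj].
  by rewrite hornerZ horner_lagrange_poly // eqxx mulr1.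
by rewrite hornerZ horner_lagrange_poly // [_ == _](negPf ne_bj) mulr0.
Qed.

Section InterpolationZ.
Variable X : choiceType.

Lemma malgUM (m1 m2 : {cmonom X}) : << mmul m1 m2 >> = << m1 >> * << m2 >> :> Qpoly X.
Proof. by rewrite [RHS]fgmulUU mulr1. Qed.

Lemma qvarX x n : << iter n (mmul (ucm x)) mone >> = qvar x ^+ n :> Qpoly X.
Proof. by elim: n => [|n IHn]; rewrite ?expr0 // iterS malgUM IHn exprS. Qed.

Lemma malg_prod_qvar (m : {cmonom X}) (D : {fset X}) : (finsupp m `<=` D)%fset ->
  << m >> = \prod_(x <- D) qvar x ^+ m x :> Qpoly X.
Proof.
move=> mD; under eq_bigr => x _ do rewrite -qvarX.
rewrite -(big_morph (fun m : {cmonom X} => << m >> : Qpoly X) malgUM (erefl _)).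
congr (<< _ >>); apply/eqP/cmP => y.
rewrite (big_morph (fun m : {cmonom X} => m y : nat) (cmM y) (cm1 y)).
have iterE x : (iter (m x) (mmul (ucm x)) mone : {cmonom X}) y = (m x * (x == y))%N.
  by elim: (m x) => [|n IHn]; rewrite ?cm1 // iterS cmM IHn cmU mulSn.
under eq_bigr => x _ do rewrite iterE.
have [yD|yD] := boolP (y \in D).
  rewrite (big_fsetD1 y) //= eqxx muln1 big1_seq ?addn0 // => x /andP[_].
  by rewrite !inE => /andP[/negPf-> _]; rewrite muln0.
rewrite big1_seq => [|x /andP[_ xD]].
  by apply/eqP; rewrite cmE_eq0; apply: contra yD; apply: (fsubsetP mD).
by case: eqP => [xy|_]; rewrite ?muln0 //; rewrite -xy xD in yD.
Qed.

Lemma qevalZ a c (q : Qpoly X) : qeval a (c *: q) = c * qeval a q.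
Proof. by rewrite /qeval mmapZ. Qed.

Lemma qeval_qbinom a (q : Qpoly X) n :
  n`!%:R * qeval a (qbinom q n) = ffactr (qeval a q) n.
Proof. by rewrite /qbinom qevalZ mulVKf ?fact_rat_neq0 // -rmorph_ffactr. Qed.

Lemma qbinom_var_intvalued (x : X) n : qbinom (qvar x) n \in @intvalued X.
Proof.
apply/asboolP => a; have [w wE] := int_binomial (a x) n; exists w.
apply: (mulfI (fact_rat_neq0 n)).
by rewrite qeval_qbinom qeval_var mulr_natl -rmorphMn wE rmorph_ffactr.
Qed.

Definition zetaZ (x : X) (n : nat) : IntZ X := MkIntZ (qbinom_var_intvalued x n).

Lemma IntZ_scalez (n : int) (q : IntZ X) : n *: q = q *~ n.
Proof. by []. Qed.

Lemma IntZ_valZ (n : int) (q : IntZ X) : IntZ_val (n *: q) = n%:~R *: IntZ_val q.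
Proof.
by rewrite scaler_int IntZ_scalez [LHS](rmorphMz (val : {rmorphism IntZ X -> Qpoly X})).
Qed.

Lemma zetaZ_fact x n : n`!%:R *: zetaZ x n = ffactr (IntZ_var x) n.
Proof.
apply: val_inj; rewrite /= IntZ_valZ rmorph_nat scalerA mulfV ?fact_rat_neq0 // scale1r.
by rewrite [RHS](rmorph_ffactr (val : {rmorphism IntZ X -> Qpoly X})).
Qed.

Definition lagrangeZ N (x : X) b : IntZ X := \sum_(k < N) newton_coef k b *: zetaZ x k.

Lemma val_lagrangeZ N x b :
  val (lagrangeZ N x b) = horner_alg (qvar x) (lagrange_poly N b).
Proof.
rewrite !rmorph_sum /=; apply: eq_bigr => k _.
rewrite linearZ IntZ_valZ /= mulr_algl; congr (_ *: _).
by rewrite linearZ /= mulr_algl rmorph_ffactr /= horner_algX.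
Qed.

Lemma qvarX_interp x n N : (n < N)%N ->
  qvar x ^+ n = \sum_(b < N) b%:R ^+ n *: val (lagrangeZ N x b) :> Qpoly X.
Proof.
move=> lt_nN; rewrite -[in LHS](horner_algX (R := rat) (qvar x)) -rmorphXn /=.
have /lagrange_poly_interp -> : (size ('X^n : {poly rat}) <= N)%N by rewrite size_polyXn.
rewrite linear_sum; apply: eq_bigr => b _.
by rewrite linearZ /= mulr_algl val_lagrangeZ hornerXn.
Qed.

Section Nodes.
Variables (D : {fset X}) (N : nat).
Implicit Type b : {ffun D -> 'I_N}.

Definition node b (x : X) : nat := if insub x is Some x' then b x' else 0.

Lemma node_val b (x : D) : node b (val x) = b x.
Proof. by rewrite /node valK. Qed.

Definition lagrange_prod b : IntZ X := \prod_(x : D) lagrangeZ N (val x) (b x).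

Definition interpolable (m : {cmonom X}) : Prop :=
  (finsupp m `<=` D)%fset /\ forall x, (m x < N)%N.

Lemma interpolable_malg (m : {cmonom X}) : interpolable m ->
  << m >> = \sum_b meval (fun x => (node b x)%:R) m *: val (lagrange_prod b) :> Qpoly X.
Proof.
move=> [mD mN]; rewrite (malg_prod_qvar mD) big_seq_fsetE /=.
under eq_bigr => x _ do rewrite (qvarX_interp _ (mN _)).
rewrite bigA_distr_bigA; apply: eq_bigr => b _.
have -> : meval (fun x => (node b x)%:R) m = \prod_(x : D) (b x)%:R ^+ m (val x).
  rewrite /meval (big_fset_incl _ mD) => [|x _]; last first.
    by rewrite -cmE_neq0 negbK => /eqP->.
  by rewrite big_seq_fsetE; apply: eq_bigr => x _; rewrite node_val.
by rewrite scaler_prod -(rmorph_prod (val : {rmorphism IntZ X -> Qpoly X})).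
Qed.

Lemma IntZ_interp (q : IntZ X) : (forall m, m \in msupp (val q) -> interpolable m) ->
  q = \sum_b IntZ_eval q (fun x => (node b x)%:Z) *: lagrange_prod b.
Proof.
move=> qDN; apply: val_inj; rewrite rmorph_sum /=.
under eq_bigr => b _ do rewrite IntZ_valZ IntZ_evalE /qeval mmapE scaler_suml.
rewrite exchange_big /= [LHS]monalgE; apply: eq_big_seq => m /qDN mDN.
rewrite malgUZ (interpolable_malg mDN) scaler_sumr; apply: eq_bigr => b _.
by rewrite scalerA.
Qed.

End Nodes.

Lemma common_interpolable (ms : seq {cmonom X}) :
  exists (D : {fset X}) (N : nat), forall m, m \in ms -> interpolable D N m.
Proof.
exists (\bigcup_(m <- ms) finsupp m)%fset, (\max_(m <- ms) mdeg m).+1 => m m_ms; split.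
  exact: (@bigfcup_sup _ _ _ _ xpredT (fun m : {cmonom X} => finsupp m)).
move=> x; rewrite ltnS; apply: (@leq_trans (mdeg m)).
  have [x_m|] := boolP (x \in finsupp m); last by rewrite -cmE_eq0 => /eqP->.
  by rewrite mdegE (big_fsetD1 x) //= leq_addr.
exact: (@leq_bigmax_seq _ _ xpredT (fun m : {cmonom X} => mdeg m)).
Qed.

Lemma IntZ_interp_seq (s : seq (IntZ X)) : exists (D : {fset X}) (N : nat),
  forall q, q \in s ->
    q = \sum_(b : {ffun D -> 'I_N}) IntZ_eval q (fun x => (node b x)%:Z) *: lagrange_prod b.
Proof.
have [D [N DN]] := common_interpolable (flatten [seq (msupp (val q) : seq _) | q <- s]).
exists D, N => q q_s; apply: IntZ_interp => m m_q; apply: DN.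
by apply/flatten_mapP; exists q.
Qed.

End InterpolationZ.

(** * Integer-valued polynomials over Z and F_p *)

Section EvaluationZ.
Variable X : choiceType.
Implicit Types (q : IntZ X) (a : X -> int).

Definition IntZ_at a q : int := IntZ_eval q a.

Lemma intr_IntZ_at a q : (IntZ_at a q)%:~R = qeval (fun x => (a x)%:~R) (val q).
Proof. exact: IntZ_evalE. Qed.

Lemma IntZ_at_zmod_morphism a : zmod_morphism (IntZ_at a).
Proof. by move=> q r; apply: (@intr_inj rat); rewrite rmorphB /= !intr_IntZ_at !rmorphB. Qed.

Lemma IntZ_at_monoid_morphism a : monoid_morphism (IntZ_at a).
Proof.
split=> [|q r]; apply: (@intr_inj rat); first by rewrite intr_IntZ_at !rmorph1.
by rewrite rmorphM /= !intr_IntZ_at !rmorphM.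
Qed.

HB.instance Definition _ a :=
  GRing.isZmodMorphism.Build (IntZ X) int (IntZ_at a) (IntZ_at_zmod_morphism a).
HB.instance Definition _ a :=
  GRing.isMonoidMorphism.Build (IntZ X) int (IntZ_at a) (IntZ_at_monoid_morphism a).

Lemma IntZ_at_var a x : IntZ_at a (IntZ_var x) = a x.
Proof. by apply: (@intr_inj rat); rewrite intr_IntZ_at qeval_var. Qed.

Lemma qeval0_mcoeff (q : Qpoly X) : qeval (fun=> 0) q = mcoeff mone q.
Proof.
rewrite {2}[q]monalgE raddf_sum /qeval mmapE; apply: eq_bigr => m _ /=.
rewrite mcoeffU; case: eqVneq => [->|m1]; first by rewrite /meval mdom1 big_seq_fset0 mulr1.
have [x x_m] : exists x, x \in finsupp m.
  apply/fset0Pn; apply: contra_neq m1 => m0; apply/eqP/cmP => y.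
  by apply/eqP; rewrite cm1 cmE_eq0 m0.
by rewrite /meval (big_fsetD1 x) //= expr0n cmE_eq0 x_m /= mul0r mulr0.
Qed.

Lemma IntZ_zero_constE q : (q \in @IntZ_zero_const X) = (IntZ_at (fun=> 0) q == 0).
Proof. by rewrite -(eqr_int rat) intr_IntZ_at qeval0_mcoeff. Qed.

End EvaluationZ.

Definition coef_lift (k : coef) : coef_ring k -> int :=
  match k with CoefZ => id | CoefF p _ => fun c : 'F_p => (c : nat)%:Z end.

Section EvaluationF.
Variables (X : choiceType) (p : nat) (p_pr : prime p).
Local Notation pi := (\pi_(IntF X p_pr) : {rmorphism IntZ X -> IntF X p_pr}).
Local Notation lift a := (@coef_lift (CoefF p_pr) \o a).
Implicit Types (q : IntZ X) (a : X -> 'F_p).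

Lemma IntZ_at_qbinom_small a x n g : (p <= n)%N -> IntZ_val g = qbinom (qvar x) n ->
  IntZ_at (lift a) g = 0.
Proof.
move=> le_pn gE; apply: (@intr_inj rat); rewrite intr_IntZ_at /= gE.
apply: (mulfI (fact_rat_neq0 n)); rewrite qeval_qbinom qeval_var mulr0 ffactr_nat.
rewrite ffact_small //; apply: leq_trans le_pn.
by rewrite -[X in (_ < X)%N](Fp_cast p_pr) ltn_ord.
Qed.

Lemma IntZ_at_ideal a q :
  q \in @IntF_ideal X p p_pr -> (IntZ_at (lift a) q)%:~R = 0 :> 'F_p.
Proof.
move=> q_ideal; elim/lspan_ind: q / q_ideal => [|r g q gen_g _ IHq]; first by rewrite !rmorph0.
rewrite rmorphD rmorphD /= IHq addr0 [IntZ_at _ _](rmorphM (IntZ_at (lift a)) r g) rmorphM.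
have [[x [n [le_pn gE]]]|->] := gen_g.
  by rewrite /= (IntZ_at_qbinom_small _ le_pn gE) mulr0.
by rewrite !rmorph_nat pchar_Fp_0 ?mulr0.
Qed.

Lemma pi_eq0 q : q \in @IntF_ideal X p p_pr -> pi q = 0.
Proof. by move=> q0; rewrite -(rmorph0 pi); apply/eqP; rewrite -Quotient.idealrBE subr0. Qed.

Lemma IntF_eval_pi q a : IntF_eval (pi q) a = (IntZ_at (lift a) q)%:~R.
Proof.
apply/eqP; rewrite -subr_eq0 -rmorphB -[X in X - _]/(IntZ_at _ _) -rmorphB.
by apply/eqP/IntZ_at_ideal; rewrite Quotient.idealrBE; apply/eqP; rewrite reprK.
Qed.

Lemma pi_zetaZ x n : (p <= n)%N -> pi (zetaZ x n) = 0.
Proof. by move=> le_pn; apply/pi_eq0/mem_lspan; left; exists x, n. Qed.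

End EvaluationF.

Section Reduction.
Variables (k : coef) (X : choiceType).
Local Notation B := (IntR k X).

Definition reduce : IntZ X -> B :=
  match k return IntZ X -> IntR k X with
  | CoefZ => id
  | CoefF p p_pr => \pi_(IntF X p_pr)
  end.

Definition IntR_repr : B -> IntZ X :=
  match k return IntR k X -> IntZ X with
  | CoefZ => id
  | CoefF p p_pr => fun q : IntF X p_pr => repr q
  end.

End Reduction.

Section ReductionTheory.
Variables (k : coef) (X : choiceType).
Local Notation R := (coef_ring k).
Local Notation B := (IntR k X).
Implicit Types (c : R) (a : X -> R) (r : IntZ X) (q : B).

Lemma coef_liftK c : (coef_lift c)%:~R = c.
Proof. by case: k c => [|p p_pr] c; [apply: intz | rewrite -pmulrn natr_Zp]. Qed.

Lemma coef_lift0 : coef_lift (0 : R) = 0.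
Proof. by case: k. Qed.

Lemma coef_lift_nat n : n`!%:R != 0 :> R -> coef_lift (n%:R : R) = n.
Proof.
case: k => [|p p_pr]; first by move=> _; apply: natz.
by rewrite fact_Fp_eq0 -ltnNge => lt_np; rewrite /= val_Fp_nat // modn_small.
Qed.

Lemma reduce_zmod_morphism : zmod_morphism (@reduce k X).
Proof. by case: k => [|p p_pr] q r //; apply: rmorphB. Qed.

Lemma reduce_monoid_morphism : monoid_morphism (@reduce k X).
Proof.
case: k => [|p p_pr]; first by split.
pose pi := \pi_(IntF X p_pr) : {rmorphism IntZ X -> IntF X p_pr}.
by split; [apply: (rmorph1 pi) | apply: (rmorphM pi)].
Qed.

HB.instance Definition _ :=
  GRing.isZmodMorphism.Build (IntZ X) B (@reduce k X) reduce_zmod_morphism.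
HB.instance Definition _ :=
  GRing.isMonoidMorphism.Build (IntZ X) B (@reduce k X) reduce_monoid_morphism.

Lemma reduceZ n r : reduce k (n *: r) = n%:~R *: reduce k r.
Proof. by rewrite scaler_int IntZ_scalez rmorphMz. Qed.

Lemma IntR_reprK : cancel (@IntR_repr k X) (@reduce k X).
Proof. by case: k => [|p p_pr] q //; apply: reprK. Qed.

Lemma reduce_var (x : X) : reduce k (IntZ_var x) = IntR_var k x.
Proof. by case: k. Qed.

Lemma reduce_zetaZ (x : X) n : n`!%:R = 0 :> R -> reduce k (zetaZ x n) = 0.
Proof.
case: k => [|p p_pr] fact_n0.
  by have := natr_coefZ_neq0 n`!; rewrite fact_n0 eqxx fact_gt0.
by apply: pi_zetaZ; rewrite -(fact_Fp_eq0 p_pr) fact_n0.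
Qed.

Definition IntR_at a q : R := IntR_eval q a.

Lemma IntR_at_reduce a r : IntR_at a (reduce k r) = (IntZ_at (@coef_lift k \o a) r)%:~R.
Proof. by rewrite /IntR_at; case: k a => [|p p_pr] a; [rewrite intz | apply: IntF_eval_pi]. Qed.

Lemma IntR_at_scalar a : scalar (IntR_at a).
Proof.
move=> c q q'; rewrite -(IntR_reprK q) -(IntR_reprK q') -[c in LHS]coef_liftK.
rewrite -reduceZ -rmorphD !IntR_at_reduce rmorphD rmorphD /=.
by rewrite IntZ_scalez !rmorphMz -[_ *~ coef_lift c]mulrzr coef_liftK mulrC.
Qed.

Lemma IntR_at_monoid_morphism a : monoid_morphism (IntR_at a).
Proof.
split=> [|q q']; first by rewrite -(rmorph1 (@reduce k X)) IntR_at_reduce !rmorph1.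
by rewrite -(IntR_reprK q) -(IntR_reprK q') -rmorphM !IntR_at_reduce !rmorphM.
Qed.

HB.instance Definition _ a :=
  GRing.isLinear.Build R B R *%R (IntR_at a) (IntR_at_scalar a).
HB.instance Definition _ a :=
  GRing.isMonoidMorphism.Build B R (IntR_at a) (IntR_at_monoid_morphism a).

Lemma IntR_at_var a (x : X) : IntR_at a (IntR_var k x) = a x.
Proof. by rewrite -reduce_var IntR_at_reduce IntZ_at_var /= coef_liftK. Qed.

End ReductionTheory.

Section Interpolation.
Variables (R : pzRingType) (U : lmodType R) (M : Type) (ev : M -> U -> R).

Definition interpolates (s : seq U) (I : finType) (a : I -> M) (e : I -> U) : Prop :=
  forall q, q \in s -> q = \sum_i ev (a i) q *: e i.

Definition interpolation_property : Prop :=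
  forall s, exists (I : finType) (a : I -> M) (e : I -> U), interpolates s a e.

End Interpolation.

Section InterpolationR.
Variables (k : coef) (X : choiceType).
Local Notation R := (coef_ring k).
Local Notation B := (IntR k X).
Local Notation reduce := (@reduce k X).
Implicit Types q r : B.

Lemma zero_constE q : (q \in @zero_const k X) = (IntR_at (fun=> 0) q == 0).
Proof.
have -> : (q \in @zero_const k X)
    = `[< exists2 r, r \in @IntZ_zero_const X & reduce r = q >].
  case: k q => [|p p_pr] q //.
  by apply/idP/asboolP => [q0|[r r0 <-] //]; exists q.
have lift0 : @coef_lift k \o (fun=> 0) = (fun=> 0) :> (X -> int).
  by apply: funext => x; apply: coef_lift0.
apply/asboolP/eqP => [[r r0 <-]|q0].
  by rewrite IntR_at_reduce lift0; move: r0; rewrite IntZ_zero_constE => /eqP->.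
exists (IntR_repr q - IntZ_at (fun=> 0) (IntR_repr q) *: 1).
  by rewrite IntZ_zero_constE IntZ_scalez rmorphB rmorphMz rmorph1 intz subrr.
rewrite rmorphB /= reduceZ IntR_reprK rmorph1 -lift0 -IntR_at_reduce IntR_reprK q0.
by rewrite scale0r subr0.
Qed.

Lemma reduce_lagrangeZ_eq0 N (x : X) b : b`!%:R = 0 :> R -> reduce (lagrangeZ N x b) = 0.
Proof.
move=> fact_b0; rewrite rmorph_sum big1 //= => n _; rewrite reduceZ.
have [/newton_coef_gt->|le_bn] := ltnP n b; first by rewrite scale0r.
by rewrite reduce_zetaZ ?scaler0 // (natr_fact_eq0_leq le_bn).
Qed.

(* If some coordinate of the node is not below the characteristic, then the product
   reduces to zero; otherwise lifting the reduced node gives back the node. *)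
Lemma IntR_at_node_lagrange_prod (D : {fset X}) N (b : {ffun D -> 'I_N}) q :
  IntR_at (fun x => (node b x)%:R) q *: reduce (lagrange_prod b)
    = (IntZ_at (fun x => (node b x)%:Z) (IntR_repr q))%:~R *: reduce (lagrange_prod b).
Proof.
have [/existsP[x /eqP fact_b0]|] := boolP [exists x, (b x)`!%:R == 0 :> R].
  suff -> : reduce (lagrange_prod b) = 0 by rewrite !scaler0.
  by rewrite rmorph_prod (bigD1 x) //= reduce_lagrangeZ_eq0 // mul0r.
rewrite negb_exists => /forallP fact_bn0.
rewrite -[in LHS](IntR_reprK q) IntR_at_reduce; congr ((IntZ_at _ _)%:~R *: _).
apply: funext => x; rewrite /= /node; case: insubP => [x' _ _|_].
  exact: coef_lift_nat.
exact: coef_lift0.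
Qed.

Lemma IntR_interp_seq (s : seq B) : exists (D : {fset X}) (N : nat),
  forall q, q \in s ->
    q = \sum_(b : {ffun D -> 'I_N})
          IntR_at (fun x => (node b x)%:R) q *: reduce (lagrange_prod b).
Proof.
have [D [N DN]] := IntZ_interp_seq [seq IntR_repr q | q <- s].
exists D, N => q q_s; under eq_bigr => b _ do rewrite IntR_at_node_lagrange_prod -reduceZ.
by rewrite -rmorph_sum -(DN _ (map_f _ q_s)) /= IntR_reprK.
Qed.

Lemma IntR_interpolation : interpolation_property (@IntR_at k X).
Proof.
move=> s; have [D [N DN]] := IntR_interp_seq s.
exists {ffun D -> 'I_N}, (fun b x => (node b x)%:R), (fun b => reduce (lagrange_prod b)).
exact: DN.
Qed.

(* The smallest subalgebra that contains the variables and is pure, i.e., closed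
   under division by nonzero scalars. *)
Inductive pure_generated : B -> Prop :=
| pure_one : pure_generated 1
| pure_var x : pure_generated (IntR_var k x)
| pure_comb c q r : pure_generated q -> pure_generated r -> pure_generated (c *: q + r)
| pure_mul q r : pure_generated q -> pure_generated r -> pure_generated (q * r)
| pure_div c q : c != 0 -> pure_generated (c *: q) -> pure_generated q.

Lemma pure_zero : pure_generated 0.
Proof. by rewrite -(addNr 1) -scaleN1r; apply: pure_comb; apply: pure_one. Qed.

Lemma pure_scale c q : pure_generated q -> pure_generated (c *: q).
Proof. by move=> pure_q; rewrite -[_ *: _]addr0; apply: pure_comb pure_q pure_zero. Qed.

Lemma pure_sum (I : Type) (s : seq I) (f : I -> B) :
  (forall i, pure_generated (f i)) -> pure_generated (\sum_(i <- s) f i).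
Proof.
move=> pure_f; apply: (big_ind pure_generated) => // [|q r pure_q]; first exact: pure_zero.
by rewrite -[q]scale1r; apply: pure_comb.
Qed.

Lemma pure_prod (I : Type) (s : seq I) (f : I -> B) :
  (forall i, pure_generated (f i)) -> pure_generated (\prod_(i <- s) f i).
Proof.
by move=> pure_f; apply: (big_ind pure_generated) => //; [apply: pure_one | apply: pure_mul].
Qed.

Lemma pure_zetaZ x n : pure_generated (reduce (zetaZ x n)).
Proof.
have [/reduce_zetaZ->|fact_n0] := eqVneq (n`!%:R : R) 0; first exact: pure_zero.
have := congr1 reduce (zetaZ_fact x n).
rewrite reduceZ rmorph_nat rmorph_ffactr /= reduce_var => zeta_fact.
apply: (pure_div fact_n0); rewrite zeta_fact; apply: pure_prod => i.
rewrite addrC -scaler_nat -scaleN1r scalerA.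
by apply: pure_comb; [apply: pure_one | apply: pure_var].
Qed.

Lemma pure_lagrange_prod (D : {fset X}) N (b : {ffun D -> 'I_N}) :
  pure_generated (reduce (lagrange_prod b)).
Proof.
rewrite rmorph_prod; apply: pure_prod => x; rewrite rmorph_sum; apply: pure_sum => n.
by rewrite /= reduceZ; apply/pure_scale/pure_zetaZ.
Qed.

Lemma IntR_pure_generated q : pure_generated q.
Proof.
have [D [N DN]] := IntR_interp_seq [:: q]; rewrite (DN q (mem_head _ _)).
by apply: pure_sum => b; apply/pure_scale/pure_lagrange_prod.
Qed.

Lemma IntR_binomial q n : zeta_range k n -> exists z, z *+ n`! = ffactr q n.
Proof.
move=> /coef_binomial_fun[w wE].
have [I [a [e eE]]] := IntR_interpolation [:: ffactr q n].
exists (\sum_i w (IntR_at (a i) q) *: e i); rewrite [RHS]eE ?mem_head // -sumrMnl.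
by apply: eq_bigr => i _; rewrite scalerMnl wE rmorph_ffactr.
Qed.

End InterpolationR.

Section AugmentationIdealTheory.
Variables (k : coef) (X : choiceType).
Local Notation R := (coef_ring k).
Local Notation B := (IntR k X).
Local Notation m := (maug k X).
Implicit Types (q r : m) (a : X -> R) (b : B).

Definition maug_at a q : R := IntR_at a (val q).

Lemma maug_at_scalar a : scalar (maug_at a).
Proof. by move=> c q r; apply: linearP. Qed.

HB.instance Definition _ a :=
  GRing.isLinear.Build R m R *%R (maug_at a) (maug_at_scalar a).

Lemma maug_atM a q r : maug_at a (maug_mul q r) = maug_at a q * maug_at a r.
Proof. exact: rmorphM. Qed.

Lemma maug_at0 q : maug_at (fun=> 0) q = 0.
Proof. by apply/eqP; rewrite -zero_constE; apply: valP. Qed.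

Lemma maug_at_var a x : maug_at a (maug_var k x) = a x.
Proof. exact: IntR_at_var. Qed.

Lemma augment_subproof b : b - IntR_at (fun=> 0) b *: 1 \in @zero_const k X.
Proof. by rewrite zero_constE linearB /= scalarZ rmorph1 mulr1 subrr. Qed.

Definition augment b : m := MkMaug (augment_subproof b).

Lemma augment_linear : linear augment.
Proof.
move=> c b b'; apply: val_inj; rewrite /= linearP scalerDl -scalerA opprD addrACA.
by rewrite scalerBr.
Qed.

HB.instance Definition _ := GRing.isLinear.Build R B m *:%R augment augment_linear.

Lemma maug_at_augment a b : maug_at a (augment b) = IntR_at a b - IntR_at (fun=> 0) b.
Proof. by rewrite /maug_at /= linearB /= scalarZ rmorph1 mulr1. Qed.

Lemma augmentK q : augment (val q) = q.
Proof. by apply: val_inj; rewrite /= [IntR_at _ _]maug_at0 scale0r subr0. Qed.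

Lemma augment1 : augment 1 = 0.
Proof. by apply: val_inj; rewrite /= rmorph1 scale1r subrr. Qed.

Lemma augment_var x : augment (IntR_var k x) = maug_var k x.
Proof. by rewrite -[RHS]augmentK. Qed.

Lemma augmentM b b' : augment (b * b') =
  IntR_at (fun=> 0) b *: augment b'
    + (IntR_at (fun=> 0) b' *: augment b + maug_mul (augment b) (augment b')).
Proof.
apply: val_inj; rewrite /= rmorphM /=; move: (IntR_at _ b) (IntR_at _ b') => c c'.
rewrite -scalerA -(mulr_algl c (c' *: 1)) -(mulr_algl c (b' - _)) -(mulr_algl c' (b - _)).
by move: (c *: 1) (c' *: 1) => x x'; ring.
Qed.

Lemma maug_interpolation : interpolation_property maug_at.
Proof.
move=> s; have [I [a [e eE]]] := IntR_interpolation [seq val q | q <- s].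
exists I, a, (augment \o e) => q q_s.
rewrite -[LHS]augmentK {1}(eE _ (map_f _ q_s)) linear_sum.
by apply: eq_bigr => i _; rewrite linearZ.
Qed.

End AugmentationIdealTheory.

(** * Tensor powers *)

Section TensorPowers.
Variables (R : comNzRingType) (U : lmodType R).
Local Notation T := (tpow U).

Lemma tnth_tset n (t : n.-tuple U) i u j :
  tnth (tset t i u) j = if j == i then u else tnth t j.
Proof. by rewrite tnth_mktuple. Qed.

Lemma tset_cons0 n (t : n.-tuple U) u v :
  tset [tuple of v :: t] ord0 u = [tuple of u :: t].
Proof.
apply: eq_from_tnth => j; rewrite tnth_tset.
by case: (unliftP ord0 j) => [j' ->|->] //; rewrite !tnthS.
Qed.

Lemma tset_consS n (t : n.-tuple U) i u v :
  tset [tuple of v :: t] (lift ord0 i) u = [tuple of v :: tset t i u].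
Proof.
apply: eq_from_tnth => j; rewrite tnth_tset.
case: (unliftP ord0 j) => [j' ->|->] //.
by rewrite (inj_eq (@lift_inj _ _)) !tnthS tnth_tset.
Qed.

Section Multilinear.
Variables (W : lmodType R) (I : finType).

Lemma multilinear_head n (f : n.+1.-tuple U -> W) (t : n.-tuple U) :
  multilinear f -> linear (fun u => f [tuple of u :: t]).
Proof.
by move=> f_lin r u v; have := f_lin [tuple of 0 :: t] ord0 r u v; rewrite !tset_cons0.
Qed.

Lemma multilinear_behead n (f : n.+1.-tuple U -> W) u :
  multilinear f -> multilinear (fun t : n.-tuple U => f [tuple of u :: t]).
Proof. by move=> f_lin t i r v w; rewrite -!tset_consS; apply: f_lin. Qed.

Lemma mktuple_cons (V : Type) n (F : 'I_n.+1 -> V) :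
  [tuple F j | j < n.+1] = [tuple of F ord0 :: [tuple F (lift ord0 j) | j < n]].
Proof.
apply: eq_from_tnth => j; rewrite tnth_mktuple.
by case: (unliftP ord0 j) => [j' ->|->] //; rewrite tnthS tnth_mktuple.
Qed.

Lemma multilinear_sum n (f : n.-tuple U -> W) (c : 'I_n -> I -> R) (e : 'I_n -> I -> U) :
    multilinear f ->
  f [tuple \sum_i c j i *: e j i | j < n]
    = \sum_(w : n.-tuple I) (\prod_j c j (tnth w j)) *: f [tuple e j (tnth w j) | j < n].
Proof.
elim: n f c e => [|n IHn] f c e f_lin.
  rewrite (big_pred1 [tuple]) => [|w]; last by rewrite [w]tuple0 /= eqxx.
  by rewrite big_ord0 scale1r; congr f; apply: eq_from_tnth => -[].
rewrite mktuple_cons; set t := [tuple \sum_i c (lift ord0 j) i *: _ | j < n].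
rewrite (linear_sumZ _ _ (multilinear_head t f_lin)).
rewrite (reindex (fun iw : I * n.-tuple I => [tuple of iw.1 :: iw.2])); last first.
  exists (fun w => (thead w, behead_tuple w)) => [[i w] _|w _] /=; last exact/esym/tuple_eta.
  by congr pair; apply: val_inj.
rewrite -(pair_bigA _ (fun i (w : n.-tuple I) => (\prod_j c j (tnth [tuple of i :: w] j)) *:
  f [tuple e j (tnth [tuple of i :: w] j) | j < n.+1])) /=.
apply: eq_bigr => i _; rewrite /t.
rewrite (IHn (fun t : n.-tuple U => f [tuple of e ord0 i :: t])); last exact: multilinear_behead.
rewrite scaler_sumr; apply: eq_bigr => w _; rewrite scalerA big_ord_recl mktuple_cons.
congr (_ * _ *: f [tuple of _ :: _]).
  by apply: eq_bigr => j _; rewrite tnthS.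
by apply: eq_from_tnth => j; rewrite !tnth_mktuple tnthS.
Qed.

End Multilinear.

Lemma tens_multilinear n : multilinear (@tens R U n).
Proof.
move=> t i r u u'.
pose pi := \pi_(lquot (@tens_rel R U n)) :
  {additive {malg R[n.-tuple U]} -> lquot (@tens_rel R U n)}.
have piZ v : r *: pi v = pi (r *: v) by apply: lquot_scale_pi.
rewrite -[LHS]/(pi _) -[RHS]/(r *: pi _ + pi _) piZ -raddfD.
apply/eqP; rewrite -Quotient.idealrBE opprD addrA.
by apply: mem_lspan; exists t, i, r, u, u'.
Qed.

Lemma tpow_ind n (P : T n -> Prop) :
  (forall r u v, P u -> P v -> P (r *: u + v)) -> (forall t, P (tens t)) -> forall u, P u.
Proof.
move=> P_comb P_tens.
have P0 : P 0.
  have := P_comb (-1) _ _ (P_tens [tuple 0 | i < n]) (P_tens [tuple 0 | i < n]).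
  by rewrite scaleN1r addNr.
move=> u; rewrite -[u]lquotK [repr u]monalgE raddf_sum /=.
apply: (big_ind P) => [|v w Pv Pw|t _]; first exact: P0.
  by rewrite -[v]scale1r; apply: P_comb.
rewrite malgUZ -lquot_scale_pi -[lquot_scale _ _]addr0.
by apply: P_comb P0; apply: P_tens.
Qed.

Section Lift.
Variables (n : nat) (u : T n).

Lemma eq_tlift (W : lmodType R) (f g : n.-tuple U -> W) : f =1 g -> tlift f u = tlift g u.
Proof. by move=> fg; apply: eq_bigr => t _; rewrite fg. Qed.

Lemma scalar_tlift (W : lmodType R) (g : {scalar W}) (f : n.-tuple U -> W) :
  g (tlift f u) = tlift (g \o f : _ -> R^o) u.
Proof. by rewrite linear_sum; apply: eq_bigr => t _; rewrite scalarZ. Qed.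

Lemma tlift_mull (c : R) (f : n.-tuple U -> R^o) :
  tlift (fun t => c * f t : R^o) u = c * tlift f u.
Proof. by rewrite mulr_sumr; apply: eq_bigr => t _; rewrite !scale_regularE mulrCA. Qed.

Lemma tlift_mulr (c : R) (f : n.-tuple U -> R^o) :
  tlift (fun t => f t * c : R^o) u = tlift f u * c.
Proof. by rewrite mulr_suml; apply: eq_bigr => t _; rewrite !scale_regularE mulrA. Qed.

End Lift.
End TensorPowers.

Section Realization.
Variables (R : comNzRingType) (U : lmodType R) (M : Type) (ev : M -> U -> R).
Local Notation T := (tpow U).
Local Notation C := (cochain R M).

Definition realize n (u : T n) : C n := fun s =>
  tlift (fun t => \prod_(i < n) ev (s i) (tnth t i) : R^o) u.

Hypothesis ev_scalar : forall a, scalar (ev a).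

Lemma prod_multilinear n (s : simplex M n) :
  multilinear (fun t : n.-tuple U => \prod_(i < n) ev (s i) (tnth t i) : R^o).
Proof.
move=> t i r u v.
have prodE w : \prod_(j < n) ev (s j) (tnth (tset t i w) j)
    = ev (s i) w * \prod_(j < n | j != i) ev (s j) (tnth t j).
  rewrite (bigD1 i) //= tnth_tset eqxx; congr (_ * _).
  by apply: eq_bigr => j /negPf ji; rewrite tnth_tset ji.
by rewrite !prodE ev_scalar scale_regularE mulrDl mulrA.
Qed.

Lemma realize_linear n : linear (@realize n).
Proof.
move=> r u v; apply: funext => s; rewrite cochainE cochainZE.
by have [lin _] := tlift_spec (prod_multilinear s); apply: lin.
Qed.

Lemma realize_tens n (t : n.-tuple U) s :
  realize (tens t) s = \prod_(i < n) ev (s i) (tnth t i).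
Proof. by have [_ tensE] := tlift_spec (prod_multilinear s); apply: tensE. Qed.

Section Interpolant.
Variables (n : nat) (I : finType) (a : I -> M) (e : I -> U).

Definition tens_interpolant (f : C n) : T n :=
  \sum_(w : n.-tuple I) f (fun j => a (tnth w j)) *: tens (map_tuple e w).

Lemma tens_interpolant_linear : linear tens_interpolant.
Proof.
move=> r f g; rewrite scaler_sumr -big_split; apply: eq_bigr => w _.
by rewrite cochainE cochainZE scalerDl scalerA.
Qed.

Lemma tens_interpolantK (t : n.-tuple U) :
  interpolates ev t a e -> tens_interpolant (realize (tens t)) = tens t.
Proof.
move=> t_e; have tE : t = [tuple \sum_i ev (a i) (tnth t j) *: e i | j < n].
  by apply: eq_from_tnth => j; rewrite tnth_mktuple -t_e ?mem_tnth.
rewrite [in RHS]tE (multilinear_sum _ _ (@tens_multilinear _ _ _)).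
apply: eq_bigr => w _; rewrite realize_tens; congr (_ *: tens _).
by apply: eq_from_tnth => j; rewrite tnth_mktuple tnth_map.
Qed.

End Interpolant.

Lemma realize_interp n (u : T n) : exists l : seq U,
  forall (I : finType) (a : I -> M) (e : I -> U),
    interpolates ev l a e -> tens_interpolant a e (realize u) = u.
Proof.
elim/tpow_ind: u => [r u v [l uE] [l' vE]|t]; last first.
  by exists t => I a e; apply: tens_interpolantK.
exists (l ++ l') => I a e ll'_e; rewrite realize_linear tens_interpolant_linear.
by rewrite uE ?vE // => q l_q; apply: ll'_e; rewrite mem_cat l_q ?orbT.
Qed.

Lemma realize_inj n : interpolation_property ev -> injective (@realize n).
Proof.
move=> interp u v uv; have [l uE] := realize_interp u; have [l' vE] := realize_interp v.
have [I [a [e ll'_e]]] := interp (l ++ l').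
rewrite -(uE I a e) ?uv => [|q l_q]; last by apply: ll'_e; rewrite mem_cat l_q.
by apply: vE => q l_q; apply: ll'_e; rewrite mem_cat l_q orbT.
Qed.

End Realization.

(** * Realization of the tensor algebra by cochains *)

(* Locked, so that unification never unfolds the lift from tensor powers. *)
HB.lock Definition psi (k : coef) (X : choiceType) (n : nat) (u : tpow (maug k X) n)
  : cochain (coef_ring k) (X -> coef_ring k) n := realize (@maug_at k X) u.

Section Psi.
Variables (k : coef) (X : choiceType).
Local Notation R := (coef_ring k).
Local Notation m := (maug k X).
Local Notation T := (tpow m).
Local Notation M := (X -> R).
Local Notation C := (cochain R M).
Local Notation A := (tensor_alg k X).
Local Notation BA := (bar_alg k X).

Lemma psiE n (u : T n) s :
  psi u s = tlift (fun t => \prod_(i < n) maug_at (s i) (tnth t i) : R^o) u.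
Proof. by rewrite psi.unlock. Qed.

Lemma psi_linear n : linear (@psi k X n).
Proof. by rewrite psi.unlock; apply: realize_linear => a; apply: linearP. Qed.

HB.instance Definition _ n :=
  GRing.isLinear.Build R (T n) (C n) *:%R (@psi k X n) (@psi_linear n).

Lemma psi_inj n : injective (@psi k X n).
Proof.
rewrite psi.unlock; apply: realize_inj; last exact: maug_interpolation.
by move=> a; apply: linearP.
Qed.

Lemma psi_tens n (t : n.-tuple m) s :
  psi (tens t) s = \prod_(i < n) maug_at (s i) (tnth t i).
Proof. by rewrite psi.unlock realize_tens // => a; apply: linearP. Qed.

Lemma psi_tlift n n' (f : n.-tuple m -> T n') (u : T n) s :
  psi (tlift f u) s = tlift (fun t => psi (f t) s : R^o) u.
Proof. exact: (scalar_tlift u (cochain_at s \o @psi k X n')). Qed.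

Lemma psi_one : psi (tens [tuple] : T 0) = fun=> 1.
Proof. by apply: funext => s; rewrite psi_tens big_ord0. Qed.

(* Rewrite with [psi_iota1] and [psi_tens2] at a designated subterm: looking for
   further instances would compare distinct tensors by unfolding them. *)
Lemma psi_iota1 (q : m) s : psi (iota1 q) s = maug_at (s ord0) q.
Proof. by rewrite psi_tens big_ord1. Qed.

Lemma psi_tens2 (q r : m) s :
  psi (tens2 q r) s = maug_at (s ord0) q * maug_at (s ord_max) r.
Proof.
rewrite psi_tens big_ord_recl big_ord1 (_ : lift ord0 ord0 = ord_max) //.
exact: val_inj.
Qed.

Lemma psi1E (u : T 1) s : psi u s = maug_at (s ord0) (deg1 u).
Proof.
rewrite psiE (scalar_tlift u (maug_at (s ord0))).
by apply: eq_tlift => t; rewrite big_ord1.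
Qed.

Lemma psi2E (w : T 2) s :
  psi w s = tlift2 (fun q r => maug_at (s ord0) q * maug_at (s ord_max) r : R^o) w.
Proof.
rewrite psiE; apply: eq_tlift => t; rewrite big_ord_recl big_ord1.
by rewrite (_ : lift ord0 ord0 = ord_max) //; apply: val_inj.
Qed.

Lemma psi_cup i j (u : A i) (v : A j) : psi (cup u v) = cup (psi u : BA i) (psi v).
Proof.
apply: funext => s; rewrite psi_tlift.
rewrite -[RHS]/(psi u _ * psi v _) [psi u _]psiE -tlift_mulr; apply: eq_tlift => t.
rewrite psi_tlift psiE -tlift_mull; apply: eq_tlift => t'.
rewrite psi_tens big_split_ord.
by congr (_ * _); apply: eq_bigr => l _; rewrite ?tnth_lshift ?tnth_rshift.
Qed.

Lemma psi_cup1 (u v : A 1) : psi (cup1 u v) = cup1 (psi u : BA 1) (psi v).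
Proof. by apply: funext => s; rewrite cochainE psi_iota1 maug_atM !psi1E. Qed.

Lemma psi_cup21 (w : A 2) (u : A 1) : psi (cup21 w u) = cup21 (psi w : BA 2) (psi u).
Proof.
apply: funext => s; rewrite cochainE psi_tlift psi2E -tlift_mulr; apply: eq_tlift => t.
rewrite linearD cochainDE /= [X in X + _]psi_tens2 [X in _ + X]psi_tens2.
by rewrite !maug_atM !psi1E; ring.
Qed.

Lemma psi_circ (v w : A 2) : psi (circ v w) = circ (psi v : BA 2) (psi w).
Proof.
apply: funext => s; rewrite cochainE psi_tlift psi2E -tlift_mulr; apply: eq_tlift => t.
rewrite psi_tlift psi2E -tlift_mull; apply: eq_tlift => t'.
by rewrite psi_tens2 !maug_atM mulrACA.
Qed.

Lemma iota1_linear : linear (@iota1 k X).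
Proof.
move=> c q r; apply: psi_inj; rewrite linearP /=; apply: funext => s.
rewrite [LHS]psi_iota1 [RHS]cochainDE cochainZE [X in _ * X]psi_iota1.
by rewrite [X in _ = _ + X]psi_iota1 linearP.
Qed.

HB.instance Definition _ :=
  GRing.isLinear.Build R m (T 1) *:%R (@iota1 k X) iota1_linear.

Lemma cup1_iota1 (q r : m) : cup1 (iota1 q : A 1) (iota1 r) = iota1 (maug_mul q r).
Proof.
apply: psi_inj; rewrite [LHS]psi_cup1; apply: funext => s.
by rewrite [RHS]psi_iota1 maug_atM cochainE [X in X * _]psi_iota1 [X in _ * X = _]psi_iota1.
Qed.

Lemma tens_cons n (q : m) (t : n.-tuple m) :
  tens [tuple of q :: t] = cup (iota1 q : A 1) (tens t : A n).
Proof.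
apply: psi_inj; rewrite [RHS](psi_cup (iota1 q : A 1) (tens t : A n)); apply: funext => s.
rewrite psi_tens big_ord_recl -[RHS]/(psi _ _ * psi _ _) psi_iota1 psi_tens.
rewrite (_ : lshift n (ord0 : 'I_1) = ord0); last exact: val_inj.
congr (_ * _); apply: eq_bigr => i _; rewrite tnthS; congr (maug_at (s _) _).
exact: val_inj.
Qed.

Lemma tensor_alg_ind (P : forall n, A n -> Prop) :
    (forall n c (u v : A n), P n u -> P n v -> P n (c *: u + v)) ->
    P 0 (gr1 A) ->
    (forall n q (u : A n), P n u -> P n.+1 (cup (iota1 q : A 1) u)) ->
  forall n (u : A n), P n u.
Proof.
move=> P_comb P1 P_cup n u; elim/tpow_ind: u => [c u v|t]; first exact: P_comb.
elim: n t => [|n IHn] t; first by rewrite [t]tuple0.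
by rewrite [t]tuple_eta tens_cons; apply: P_cup.
Qed.

End Psi.

(** * Pulling back structure along an embedding *)

Section Pullback.
Variables (R : comNzRingType) (A B : cupone_alg R).
Variables (dA : degree1_map A) (dB : degree1_map B).
Variable f : forall n, {linear A n -> B n}.

Definition cupone_hom : Prop :=
  [/\ f 0 (gr1 A) = gr1 B,
      forall i j (a : A i) (b : A j), f _ (cup a b) = cup (f _ a) (f _ b),
      forall a b : A 1, f _ (cup1 a b) = cup1 (f _ a) (f _ b),
      forall (w : A 2) (a : A 1), f _ (cup21 w a) = cup21 (f _ w) (f _ a)
    & forall v w : A 2, f _ (circ v w) = circ (f _ v) (f _ w)].

Definition unitized_map (x : unitized A) : unitized B := (x.1, f 1 x.2).

Lemma unitized_map_linear : linear unitized_map.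
Proof. by move=> r x y; congr pair; rewrite /= linearP. Qed.

HB.instance Definition _ := GRing.isLinear.Build R (unitized A) (unitized B) *:%R
  unitized_map unitized_map_linear.

Lemma unitized_map1 : unitized_map (uone A) = uone B.
Proof. by rewrite /unitized_map /= linear0. Qed.

Lemma gcast_linear i j (e : i = j) (u : A i) : f j (gcast e u) = gcast e (f i u).
Proof. by case: j / e. Qed.

Hypothesis f_hom : cupone_hom.
Let f1 : f 0 (gr1 A) = gr1 B. Proof. by have [] := f_hom. Qed.
Let f_cup : forall i j (a : A i) (b : A j), f _ (cup a b) = cup (f _ a) (f _ b).
Proof. by have [] := f_hom. Qed.
Let f_cup1 : forall a b : A 1, f _ (cup1 a b) = cup1 (f _ a) (f _ b).
Proof. by have [] := f_hom. Qed.
Let f_cup21 : forall (w : A 2) (a : A 1), f _ (cup21 w a) = cup21 (f _ w) (f _ a).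
Proof. by have [] := f_hom. Qed.
Let f_circ : forall v w : A 2, f _ (circ v w) = circ (f _ v) (f _ w).
Proof. by have [] := f_hom. Qed.

Lemma unitized_mapM : {morph unitized_map : x y / umul x y >-> umul x y}.
Proof. by move=> x y; rewrite /unitized_map /= !linearD !linearZ f_cup1. Qed.

Lemma hom_decomp w : w \in @decomp R A -> f 2 w \in @decomp R B.
Proof.
move=> Dw; elim/lspan_ind: w / Dw => [|r _ v [a [b ->]] _ Dv].
  by rewrite linear0; apply: rpred0.
rewrite linearP; apply: rpredD Dv; apply: rpredZ; apply: mem_lspan.
by exists (f 1 a), (f 1 b); apply: f_cup.
Qed.

Hypothesis f_inj : forall n, injective (f n).

Lemma unitized_map_inj : injective unitized_map.
Proof. by move=> [r a] [s b] [-> /f_inj->]. Qed.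

Lemma pullback_graded_algebra : is_graded_algebra B -> is_graded_algebra A.
Proof.
move=> [cup_linl cup_linr cupA cup1l cup1r].
split=> [i j b r a a'|i j a r b b'|i j l a b c|i a|i a]; apply: f_inj.
- by rewrite linearP !f_cup linearP cup_linl.
- by rewrite linearP !f_cup linearP cup_linr.
- by rewrite gcast_linear !f_cup cupA.
- by rewrite (f_cup (gr1 A) a) f1 cup1l.
- by rewrite gcast_linear f_cup f1 cup1r.
Qed.

Lemma pullback_unitized_comm_algebra :
  comm_algebra (uone B) (@umul R B) -> comm_algebra (uone A) (@umul R A).
Proof.
move=> [mulC mulA mul1x mul_lin].
split=> [x y|x y z|x|x r y z]; apply: unitized_map_inj.
- by rewrite !unitized_mapM mulC.
- by rewrite !unitized_mapM mulA.
- by rewrite unitized_mapM unitized_map1 mul1x.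
- by rewrite unitized_mapM !linearP /= !unitized_mapM mul_lin.
Qed.

Definition lifts_d n (u : A n) (w : A n.+1) : Prop := f _ w = dB (f _ u).

Lemma lifts_d_inj n (u : A n) w w' : lifts_d u w -> lifts_d u w' -> w = w'.
Proof. by rewrite /lifts_d => <- /f_inj. Qed.

Lemma lifts_d_comb n c (u u' : A n) w w' : linear (@dB n) ->
  lifts_d u w -> lifts_d u' w' -> lifts_d (c *: u + u') (c *: w + w').
Proof. by rewrite /lifts_d => dB_lin uw uw'; rewrite !linearP dB_lin uw uw'. Qed.

Lemma lifts_d_cup i j (u : A i) (v : A j) w w' : graded_leibniz dB ->
    lifts_d u w -> lifts_d v w' ->
  lifts_d (cup u v) (cup w v + (-1) ^+ i *: gcast (addnS i j) (cup u w')).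
Proof.
rewrite /lifts_d => leib uw vw'.
by rewrite linearD linearZ /= gcast_linear (f_cup w v) (f_cup u w') f_cup leib uw vw'.
Qed.

Lemma lifts_d_cup1 (u v : A 1) w w' : cup1_d_formula dB (f _ u) (f _ v) ->
    lifts_d u w -> lifts_d v w' ->
  lifts_d (cup1 u v) (- cup u v - cup v u + cup21 w v + cup21 w' u - circ w w').
Proof.
rewrite /lifts_d => d_cup1 uw vw'.
have f_rhs a b c d e : f 2 (- a - b + c + d - e) = - f 2 a - f 2 b + f 2 c + f 2 d - f 2 e.
  by rewrite linearB !linearD !linearN.
apply: etrans (f_rhs _ _ _ _ _) _.
by rewrite f_circ !f_cup21 (f_cup u v) (f_cup v u) f_cup1 d_cup1 uw vw'.
Qed.

Hypothesis f_d : forall n (u : A n), lifts_d u (dA u).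

Lemma pullback_leibniz : graded_leibniz dB -> graded_leibniz dA.
Proof. by move=> leib i j a b; apply/(lifts_d_inj (f_d _))/lifts_d_cup. Qed.

Lemma pullback_cup1_d a b : cup1_d_formula dB (f _ a) (f _ b) -> cup1_d_formula dA a b.
Proof. by move=> d_cup1; apply: lifts_d_inj (f_d _) (lifts_d_cup1 d_cup1 _ _). Qed.

Lemma pullback_d_linear n : linear (@dB n) -> linear (@dA n).
Proof. by move=> dB_lin c u v; apply: lifts_d_inj (f_d _) (lifts_d_comb _ _ _ _). Qed.

Lemma pullback_dga : is_dga dB -> is_dga dA.
Proof.
move=> [B_alg dB_lin dB2 leib]; split.
- exact: pullback_graded_algebra.
- by move=> n; apply: pullback_d_linear.
- by move=> n a; apply: f_inj; rewrite !f_d dB2 linear0.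
- exact: pullback_leibniz.
Qed.

Lemma pullback_ops_linear : cupone_ops_linear B -> cupone_ops_linear A.
Proof.
move=> [cup1_linl cup1_linr cup21_linl cup21_linr].
split=> [b r a a'|a r b b'|r v w b Dv Dw|w Dw r a b]; apply: f_inj.
- by rewrite linearP !f_cup1 linearP cup1_linl.
- by rewrite linearP !f_cup1 linearP cup1_linr.
- by rewrite linearP !f_cup21 linearP cup21_linl //; apply: hom_decomp.
- by rewrite linearP !f_cup21 linearP cup21_linr //; apply: hom_decomp.
Qed.

Lemma pullback_circ_cup :
    (forall u v w z : B 1, circ (cup u v) (cup w z) = cup (cup1 u w) (cup1 v z)) ->
  forall u v w z : A 1, circ (cup u v) (cup w z) = cup (cup1 u w) (cup1 v z).
Proof.
move=> circ_cup u v w z; apply: f_inj.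
rewrite f_circ (f_cup u v) (f_cup w z) (f_cup (cup1 u w) (cup1 v z)).
by rewrite !f_cup1 circ_cup.
Qed.

Lemma pullback_circ_ops_linear : cupone_axioms dB -> circ_ops_linear B -> circ_ops_linear A.
Proof.
move=> [_ _ circ_cup _ _] [_ circ_linlB circ_linrB].
have circ_linl r (u v w : A 2) :
    u \in @decomp R A -> v \in @decomp R A -> w \in @decomp R A ->
  circ (r *: u + v) w = r *: circ u w + circ v w.
  move=> Du Dv Dw; apply: f_inj.
  by rewrite linearP !f_circ linearP circ_linlB //; apply: hom_decomp.
have circ_linr r (u v w : A 2) :
    u \in @decomp R A -> v \in @decomp R A -> w \in @decomp R A ->
  circ w (r *: u + v) = r *: circ w u + circ w v.
  move=> Du Dv Dw; apply: f_inj.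
  by rewrite linearP !f_circ linearP circ_linrB //; apply: hom_decomp.
by split=> //; apply: circ_decomp => //; apply: pullback_circ_cup.
Qed.

Lemma pullback_cupone_axioms : cupone_axioms dB -> cupone_axioms dA.
Proof.
move=> [unitizedB cup21_cup circ_cup cup1_d0 cup1_d].
split=> [|a b c|u v w z|a c|a b Da Db].
- exact: pullback_unitized_comm_algebra.
- apply: f_inj; rewrite linearD f_cup21 (f_cup a b) (f_cup a (cup1 b c)).
  by rewrite (f_cup (cup1 a c) b) !f_cup1 cup21_cup.
- exact: pullback_circ_cup.
- by apply: f_inj; rewrite linearB /= f_cup1 f_d cup1_d0 (f_cup a c) (f_cup c a).
- by apply/pullback_cup1_d/cup1_d; rewrite -f_d; apply: hom_decomp.
Qed.

Lemma pullback_cupone_dga : is_cupone_dga dB -> is_cupone_dga dA.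
Proof.
move=> [dgaB opsB circB axiomsB]; split.
- exact: pullback_dga.
- exact: pullback_ops_linear.
- exact: pullback_circ_ops_linear.
- exact: pullback_cupone_axioms.
Qed.

End Pullback.

(** * Separable functions of two points *)

Section Separable.
Variables (k : coef) (X : choiceType).
Local Notation R := (coef_ring k).
Local Notation B := (IntR k X).
Local Notation M := (X -> R).
Implicit Types f g : M -> M -> R.

Definition separable f : Prop := exists l : seq (B * B),
  forall a a', f a a' = \sum_(p <- l) IntR_at a p.1 * IntR_at a' p.2.

Lemma eq_separable f g : (forall a a', f a a' = g a a') -> separable f -> separable g.
Proof. by move=> fg [l lE]; exists l => a a'; rewrite -fg lE. Qed.

Lemma separable_tensor (q r : B) : separable (fun a a' => IntR_at a q * IntR_at a' r).
Proof. by exists [:: (q, r)] => a a'; rewrite big_seq1. Qed.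

Lemma separable_comb c f g : separable f -> separable g ->
  separable (fun a a' => c * f a a' + g a a').
Proof.
move=> [l lE] [l' lE']; exists ([seq (c *: p.1, p.2) | p <- l] ++ l') => a a'.
rewrite big_cat big_map /= lE lE' mulr_sumr; congr (_ + _).
by apply: eq_bigr => p _; rewrite scalarZ mulrA.
Qed.

Lemma separable_left (q : B) : separable (fun a _ => IntR_at a q).
Proof. by apply: eq_separable (separable_tensor q 1) => a a'; rewrite rmorph1 mulr1. Qed.

Lemma separable_right (q : B) : separable (fun _ a => IntR_at a q).
Proof. by apply: eq_separable (separable_tensor 1 q) => a a'; rewrite rmorph1 mul1r. Qed.

Lemma separableD f g : separable f -> separable g -> separable (fun a a' => f a a' + g a a').
Proof. by move=> sf sg; apply: eq_separable (separable_comb 1 sf sg) => a a'; rewrite mul1r. Qed.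

Lemma separableB f g : separable f -> separable g -> separable (fun a a' => f a a' - g a a').
Proof.
by move=> sf sg; apply: eq_separable (separable_comb (-1) sg sf) => a a'; rewrite mulN1r addrC.
Qed.

Lemma separableM f g : separable f -> separable g -> separable (fun a a' => f a a' * g a a').
Proof.
move=> [l lE] [l' lE'].
exists [seq (p.1 * p'.1, p.2 * p'.2) | p <- l, p' <- l'] => a a'.
rewrite big_allpairs_dep lE lE' mulr_suml; apply: eq_bigr => p _.
by rewrite mulr_sumr; apply: eq_bigr => p' _; rewrite !rmorphM mulrACA.
Qed.

Lemma separable_interp f : separable f ->
  exists (I : finType) (u : I -> M) (e : I -> B), forall a a',
    f a a' = \sum_(ij : I * I)
      f (u ij.1) (u ij.2) * (IntR_at a (e ij.1) * IntR_at a' (e ij.2)).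
Proof.
move=> [l lE].
have [I [u [e eE]]] := IntR_interpolation ([seq p.1 | p <- l] ++ [seq p.2 | p <- l]).
exists I, u, e => a a'; rewrite lE; under [RHS]eq_bigr => ij _ do rewrite lE mulr_suml.
rewrite exchange_big; apply: eq_big_seq => p p_l.
have at_interp b q : q \in [seq p.1 | p <- l] ++ [seq p.2 | p <- l] ->
    IntR_at b q = \sum_i IntR_at (u i) q * IntR_at b (e i).
  by move=> /eE {1}->; rewrite linear_sum; apply: eq_bigr => i _; rewrite scalarZ.
rewrite [IntR_at a _]at_interp ?mem_cat ?map_f // [IntR_at a' _]at_interp; last first.
  by rewrite mem_cat orbC map_f.
rewrite big_distrlr pair_big /=.
by apply: eq_bigr => ij _; rewrite mulrACA.
Qed.

(* Interpolation expresses a separable function through its own values, so a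
   common factor of the values divides the coefficients. *)
Lemma separable_div c f : c != 0 -> separable (fun a a' => c * f a a') -> separable f.
Proof.
move=> c0 /separable_interp[I [u [e fE]]].
exists [seq (f (u ij.1) (u ij.2) *: e ij.1, e ij.2) | ij <- index_enum (I * I)%type] => a a'.
apply: (coef_mulfI c0); rewrite fE big_map mulr_sumr; apply: eq_bigr => ij _.
by rewrite /= scalarZ -!mulrA.
Qed.

Lemma separable_realized f : separable f ->
    (forall a, f a (fun=> 0) = 0) -> (forall a', f (fun=> 0) a' = 0) ->
  exists w : tpow (maug k X) 2, forall s, psi w s = f (s ord0) (s ord_max).
Proof.
move=> [l lE] f_right0 f_left0.
exists (\sum_(p <- l) tens2 (augment p.1) (augment p.2)) => s.
rewrite -[LHS]/((cochain_at s \o @psi k X 2) _) linear_sum /= /cochain_at.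
under eq_bigr => p _ do rewrite psi_tens2 !maug_at_augment.
transitivity (f (s ord0) (s ord_max) - f (fun=> 0) (s ord_max)
    - f (s ord0) (fun=> 0) + f (fun=> 0) (fun=> 0)); last first.
  by rewrite !f_right0 f_left0 !subr0 addr0.
by rewrite !lE -!sumrB -big_split /=; apply: eq_bigr => p _; ring.
Qed.

Definition simplex2 (a a' : M) : simplex M 2 := fun i => if i == ord0 then a else a'.

Lemma simplex2_eta (s : simplex M 2) : simplex2 (s ord0) (s ord_max) = s.
Proof.
apply: funext => i; rewrite /simplex2; case: (unliftP ord0 i) => [j ->|->] //.
by rewrite ord1; congr s; apply: val_inj.
Qed.

Lemma separable_psi (w : tpow (maug k X) 2) : separable (fun a a' => psi w (simplex2 a a')).
Proof.
elim/tpow_ind: w => [c u v su sv|t].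
  by apply: eq_separable (separable_comb c su sv) => a a'; rewrite [psi (_ + _)]linearP.
apply: eq_separable (separable_tensor (val (tnth t ord0)) (val (tnth t ord_max))) => a a'.
rewrite psi_tens big_ord_recl big_ord1 (_ : lift ord0 ord0 = ord_max) //.
exact: val_inj.
Qed.

End Separable.

(** * The differential *)

Lemma gcast_id (R : comNzRingType) (A : cupone_alg R) n (e : n = n) (u : A n) : gcast e u = u.
Proof. by rewrite (eq_irrelevance e (erefl n)). Qed.

Lemma leibniz_unit (R : comNzRingType) (A : cupone_alg R) (d : degree1_map A) :
  is_graded_algebra A -> graded_leibniz d -> d 0 (gr1 A) = 0.
Proof.
move=> [_ _ _ cup1l cup1r] leib; apply: (addrI (d 0 (gr1 A))).
have d11 := leib 0 0 (gr1 A) (gr1 A).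
have d1r := cup1r 1 (d 0 (gr1 A)); rewrite gcast_id in d1r.
rewrite expr0 scale1r gcast_id in d11.
by rewrite addr0 -{1}d1r -[X in _ + X]cup1l -d11 cup1l.
Qed.

Section Differential.
Variables (k : coef) (X : choiceType) (tau : X -> tpow (maug k X) 2).
Local Notation R := (coef_ring k).
Local Notation B := (IntR k X).
Local Notation M := (X -> R).
Local Notation A := (tensor_alg k X).
Local Notation BA := (bar_alg k X).
Local Notation mu := (mu tau).
Local Notation zeroM := ((fun=> 0) : M).
Local Notation psi_lin := (fun n => @psi k X n : {linear A n -> BA n}).
Local Notation lifts := (lifts_d (d_bar tau) psi_lin).

Lemma psi_hom : cupone_hom psi_lin.
Proof.
split.
- exact: psi_one.
- exact: psi_cup.
- exact: psi_cup1.
- exact: psi_cup21.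
- exact: psi_circ.
Qed.

Lemma muE a a' x : mu a a' x = a x + a' x - psi (tau x) (simplex2 a a').
Proof. by rewrite psi2E. Qed.

Lemma psi_zero_node n (w : A n) (s : simplex M n) (i : 'I_n) :
  s i = zeroM -> psi w s = 0.
Proof.
move=> si0; elim/tpow_ind: w => [c u v u0 v0|t].
  by rewrite linearP /= cochainE cochainZE u0 v0 mulr0 addr0.
by rewrite psi_tens (bigD1 i) //= si0 maug_at0 mul0r.
Qed.

Lemma mu0r a : mu a zeroM = a.
Proof. by apply: funext => x; rewrite muE (psi_zero_node _ (i := ord_max)) // subr0 addr0. Qed.

Lemma mu0l a : mu zeroM a = a.
Proof. by apply: funext => x; rewrite muE (psi_zero_node _ (i := ord0)) // subr0 add0r. Qed.

Lemma separable_eval_mu (q : B) : separable (fun a a' => IntR_at (mu a a') q).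
Proof.
elim: {q}(IntR_pure_generated q) => [|x|c q r _ sq _ sr|q r _ sq _ sr|c q c0 _ sq].
- by apply: eq_separable (separable_left 1) => a a'; rewrite !rmorph1.
- have sep_sum := separableD (separable_left (IntR_var k x)) (separable_right (IntR_var k x)).
  apply: eq_separable (separableB sep_sum (separable_psi (tau x))) => a a'.
  by rewrite !IntR_at_var muE.
- by apply: eq_separable (separable_comb c sq sr) => a a'; rewrite linearP.
- by apply: eq_separable (separableM sq sr) => a a'; rewrite rmorphM.
- by apply: (separable_div c0); apply: eq_separable sq => a a'; rewrite scalarZ.
Qed.

Lemma lifts_iota1_exists q : exists w, lifts (iota1 q : A 1) w.
Proof.
pose f a a' := maug_at a q + maug_at a' q - maug_at (mu a a') q.
have [|a|a|w wE] := @separable_realized k X f.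
- have sep_sum := separableD (separable_left (val q)) (separable_right (val q)).
  exact: separableB sep_sum (separable_eval_mu (val q)).
- by rewrite /f mu0r maug_at0 addr0 subrr.
- by rewrite /f mu0l maug_at0 add0r subrr.
by exists w; apply: funext => s; rewrite /lifts_d /= wE [RHS]bar_d1E !psi_iota1.
Qed.

Lemma lifts_one : lifts (gr1 A) 0.
Proof. by rewrite /lifts_d linear0 /d_bar bar_d0E. Qed.

Lemma lifts_var x : lifts (iota1 (maug_var k x) : A 1) (tau x).
Proof.
apply: funext => s; rewrite [RHS]bar_d1E /= !psi_iota1 !maug_at_var muE.
by rewrite simplex2_eta subKr.
Qed.

Lemma lifts_exists n (u : A n) : exists w, lifts u w.
Proof.
elim/tensor_alg_ind: n / u => [n c u v [w uw] [w' vw']||n q u [w uw]].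
- by exists (c *: w + w'); apply: lifts_d_comb uw vw'; apply: bar_d_linear.
- by exists 0; apply: lifts_one.
- have [w' qw'] := lifts_iota1_exists q; eexists.
  by apply: lifts_d_cup qw' uw; [apply: psi_hom | apply: bar_leibniz].
Qed.

Definition lifted_d : degree1_map A := fun n u => sval (cid (lifts_exists u)).

Lemma lifted_dP n (u : A n) : lifts u (lifted_d u).
Proof. exact: svalP (cid (lifts_exists u)). Qed.

Lemma lifted_d_is_d_tau : is_d_tau tau lifted_d.
Proof.
split.
- move=> n; exact: (pullback_d_linear (f := psi_lin) (@psi_inj k X) lifted_dP
    (@bar_d_linear _ _ _ n)).
- move=> x.
  exact: (lifts_d_inj (f := psi_lin) (@psi_inj k X) (lifted_dP _) (lifts_var x)).
- exact: (pullback_leibniz psi_hom (@psi_inj k X) lifted_dP (@bar_leibniz _ _ _)).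
- move=> a b; apply: (pullback_cup1_d psi_hom (@psi_inj k X) lifted_dP).
  exact: bar_cup1_d.
Qed.

Section Uniqueness.
Variable d : degree1_map A.
Hypothesis d_tauP : is_d_tau tau d.

Let d_lin n : linear (@d n). Proof. by have [] := d_tauP. Qed.
Let d_leibniz : graded_leibniz d. Proof. by have [] := d_tauP. Qed.

Lemma d_tau_lifts_comb n c (u v : A n) :
  lifts u (d u) -> lifts v (d v) -> lifts (c *: u + v) (d (c *: u + v)).
Proof.
move=> ud vd; rewrite [d _]d_lin.
exact: (lifts_d_comb (f := psi_lin) c (@bar_d_linear R M mu n) ud vd).
Qed.

Lemma d_tau_lifts_cup i j (u : A i) (v : A j) :
  lifts u (d u) -> lifts v (d v) -> lifts (cup u v) (d (cup u v)).
Proof.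
by move=> ud vd; rewrite d_leibniz; apply: lifts_d_cup ud vd;
  [apply: psi_hom | apply: bar_leibniz].
Qed.

Lemma d_tau_lifts_cup1 (u v : A 1) :
  lifts u (d u) -> lifts v (d v) -> lifts (cup1 u v) (d (cup1 u v)).
Proof.
have [_ _ _ d_cup1] := d_tauP; move=> ud vd; rewrite d_cup1.
by apply: lifts_d_cup1 ud vd; [apply: psi_hom | apply: bar_cup1_d].
Qed.

Lemma d_tau_lifts_one : lifts (gr1 A) (d (gr1 A)).
Proof.
rewrite leibniz_unit //; first exact: lifts_one.
exact: (pullback_graded_algebra psi_hom (@psi_inj k X) (bar_graded_algebra _ _)).
Qed.

Lemma d_tau_lifts_zero n : lifts (0 : A n) (d 0).
Proof.
have d0 : d (0 : A n) = 0.
  by have := GRing.zmod_morphism_linear (@d_lin n) 0 0; rewrite !subrr.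
rewrite /lifts_d d0 !linear0.
exact: esym (linear0 (@bar_d R M mu n)).
Qed.

Lemma d_tau_lifts_div n c (u : A n) :
  c != 0 -> lifts (c *: u) (d (c *: u)) -> lifts u (d u).
Proof.
move=> c0; rewrite /lifts_d (GRing.scalable_linear (@d_lin n)) !linearZ.
rewrite [d_bar _ _](GRing.scalable_linear (@bar_d_linear _ _ mu n)) => lift_cu.
apply: funext => s; apply: (coef_mulfI c0).
exact: (congr1 (fun g : BA n.+1 => g s) lift_cu).
Qed.

Lemma d_tau_lifts_iota1 q : lifts (iota1 q : A 1) (d (iota1 q)).
Proof.
rewrite -[q]augmentK.
elim: {q}(IntR_pure_generated (val q)) => [|x|c b b' _ lb _ lb'|b b' _ lb _ lb'|c b c0 _ lb].
- by rewrite augment1 [iota1 0]linear0; exact: d_tau_lifts_zero.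
- by have [_ d_var _ _] := d_tauP; rewrite augment_var d_var; apply: lifts_var.
- by rewrite augment_linear iota1_linear; exact: d_tau_lifts_comb lb lb'.
- have lbb' : lifts (iota1 (maug_mul (augment b) (augment b')) : A 1)
      (d (iota1 (maug_mul (augment b) (augment b')))).
    by rewrite -cup1_iota1; exact: d_tau_lifts_cup1 lb lb'.
  rewrite augmentM iota1_linear; apply: (d_tau_lifts_comb _ lb').
  by rewrite iota1_linear; exact: d_tau_lifts_comb lb lbb'.
- by move: lb; rewrite [augment _]linearZ [iota1 _]linearZ; exact: d_tau_lifts_div.
Qed.

Lemma d_tau_lifts n (u : A n) : lifts u (d u).
Proof.
elim/tensor_alg_ind: n / u => [n c u v||n q u].
- exact: d_tau_lifts_comb.
- exact: d_tau_lifts_one.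
- exact: d_tau_lifts_cup (d_tau_lifts_iota1 q).
Qed.

End Uniqueness.

Lemma d_tau_unique : unique (is_d_tau tau) (d_tau tau).
Proof.
have d_tauP : is_d_tau tau (d_tau tau).
  rewrite /d_tau; case: pselect => [ex|[]]; first by case: (cid ex).
  by exists lifted_d; apply: lifted_d_is_d_tau.
split=> // d dP; apply: functional_extensionality_dep => n; apply: funext => u.
exact: (lifts_d_inj (f := psi_lin) (@psi_inj k X) (d_tau_lifts d_tauP u) (d_tau_lifts dP u)).
Qed.

Lemma psi_d n (u : A n) : psi (d_tau tau u) = d_bar tau (psi u).
Proof. by have [d_tauP _] := d_tau_unique; apply: d_tau_lifts. Qed.

End Differential.

(** * Binomial structures *)

Section BarBinomial.
Variables (k : coef) (M : Type).
Local Notation R := (coef_ring k).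
Local Notation A := (bar_cochains R M).

Lemma bar_deg0_binomial_algebra :
  binomial_algebra (gr1 A) (fun a b : A 0 => cup a b : A 0).
Proof.
apply: (separating_binomial_algebra
  (chi := fun s => cochain_at s : {scalar A 0})) => [//|s f g|f g fg|f n n_k].
- by rewrite /= /cochain_at; congr (f _ * g _); apply: simplex0_eq.
- by apply: funext => s; apply: fg.
- have [w wE] := coef_binomial_fun n_k.
  by exists (fun s => w (f s)) => s; apply: wE.
Qed.

Lemma bar_unitized_binomial_algebra : binomial_algebra (uone A) (@umul R A).
Proof.
apply: (separating_binomial_algebra (chi := fun i => bar_character i : {scalar unitized A})).
- exact: bar_character1.
- exact: bar_characterM.
- exact: bar_character_inj.
- move=> x n /coef_binomial_fun[w wE].
  exists ((w x.1, fun s => w (x.1 + x.2 s) - w x.1) : unitized A) => -[s|]; last exact: wE.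
  by rewrite /= addrC subrK wE.
Qed.

Lemma bar_is_binomial_cupone_dga (op : M -> M -> M) :
  associative op -> is_binomial_cupone_dga (@bar_d R M op : degree1_map A).
Proof.
move=> opA; split; first exact: bar_is_cupone_dga.
- exact: bar_deg0_binomial_algebra.
- exact: bar_unitized_binomial_algebra.
Qed.

End BarBinomial.

Section TensorBinomial.
Variables (k : coef) (X : choiceType).
Local Notation R := (coef_ring k).
Local Notation M := (X -> R).
Local Notation A := (tensor_alg k X).
Local Notation BA := (bar_alg k X).
Local Notation zeroM := ((fun=> 0) : M).
Local Notation psi_lin := (fun n => @psi k X n : {linear A n -> BA n}).

Lemma tensor_deg0_binomial_algebra :
  binomial_algebra (gr1 A) (fun a b : A 0 => cup a b : A 0).
Proof.
apply: (separating_binomial_algebra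
  (chi := fun s => cochain_at s \o @psi k X 0 : {scalar A 0})) => [s|s u v|u v uv|u n n_k].
- by rewrite /= psi_one.
- rewrite /= (psi_cup u v) /cochain_at.
  by congr (psi u _ * psi v _); apply: simplex0_eq.
- by apply/psi_inj/funext.
- have [w wE] := coef_binomial_fun n_k.
  exists (w (psi u (fun=> zeroM)) *: gr1 A) => s.
  rewrite scalarZ /= psi_one /cochain_at mulr1 wE.
  by rewrite (simplex0_eq s (fun=> zeroM)).
Qed.

Lemma tensor_character_binomial (x : unitized A) n : zeta_range k n ->
  exists z, forall i, bar_character i (unitized_map psi_lin z) *+ n`!
    = ffactr (bar_character i (unitized_map psi_lin x)) n.
Proof.
move=> n_k; pose b : IntR k X := x.1 *: 1 + val (deg1 x.2).
have bE a : IntR_at a b = x.1 + maug_at a (deg1 x.2) by rewrite linearP /= rmorph1 mulr1.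
have [z zE] := IntR_binomial b n_k.
exists ((IntR_at zeroM z, iota1 (augment z)) : unitized A) => -[s|] /=; last first.
  by rewrite -rmorphMn zE rmorph_ffactr /= bE maug_at0 addr0.
rewrite psi_iota1 maug_at_augment psi1E addrC subrK -rmorphMn zE.
by rewrite rmorph_ffactr /= bE.
Qed.

Let tensor_character i : {scalar unitized A} := bar_character i \o unitized_map psi_lin.

Let tensor_character1 i : tensor_character i (uone A) = 1.
Proof. by rewrite /= unitized_map1 bar_character1. Qed.

Let tensor_characterM i : {morph tensor_character i : x y / umul x y >-> x * y}.
Proof. by move=> x y; rewrite /= (unitized_mapM (psi_hom k X)) bar_characterM. Qed.

Let tensor_character_inj x y :
  (forall i, tensor_character i x = tensor_character i y) -> x = y.
Proof.
move=> xy; apply: (unitized_map_inj (f := psi_lin) (@psi_inj k X)).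
exact: bar_character_inj.
Qed.

Lemma tensor_unitized_binomial_algebra : binomial_algebra (uone A) (@umul R A).
Proof.
exact: (separating_binomial_algebra tensor_character1 tensor_characterM tensor_character_inj
  tensor_character_binomial).
Qed.

Lemma psi_zeta1 n (u : A 1) : zeta_range k n -> psi (zeta1 n u) = zeta1 n (psi u : BA 1).
Proof.
move=> n_k; rewrite -[LHS]/((unitized_map psi_lin (zeta _ _ n (0, u))).2); congr snd.
apply: (raddf_zeta (f := unitized_map psi_lin)).
- exact/unitized_mapM/psi_hom.
- exact: unitized_map1.
- exact: (separating_falling_divisible tensor_character1 tensor_characterM
    tensor_character_inj tensor_character_binomial).
- exact: (separating_mulrn_inj (chi := fun i => bar_character i : {scalar unitized BA})
    (@bar_character_inj R M) (fact_coef_neq0 n_k)).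
Qed.

Lemma tensor_alg_morphism_ext (C : cupone_alg R) (f g : forall n, A n -> C n) :
    (forall n, linear (@f n)) -> (forall n, linear (@g n)) ->
    f 0 (gr1 A) = g 0 (gr1 A) ->
    (forall i j (u : A i) (v : A j), f _ (cup u v) = cup (f _ u) (f _ v)) ->
    (forall i j (u : A i) (v : A j), g _ (cup u v) = cup (g _ u) (g _ v)) ->
    (forall q, f 1 (iota1 q) = g 1 (iota1 q)) ->
  forall n (u : A n), f n u = g n u.
Proof.
move=> f_lin g_lin fg1 f_cup g_cup fg_iota1 n u.
elim/tensor_alg_ind: n / u => [n c u v fgu fgv|//|n q u fgu].
  by rewrite f_lin g_lin fgu fgv.
by rewrite (f_cup 1 n) (g_cup 1 n) fg_iota1 fgu.
Qed.

End TensorBinomial.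

Section Embedding.
Variables (k : coef) (X : choiceType) (tau : X -> tpow (maug k X) 2).
Local Notation A := (tensor_alg k X).
Local Notation BA := (bar_alg k X).

Lemma tensor_is_cupone_dga : admissible tau -> is_cupone_dga (d_tau tau).
Proof.
move=> tau_adm.
exact: (pullback_cupone_dga (psi_hom k X) (@psi_inj k X) (@psi_d k X tau)
  (bar_is_cupone_dga _ tau_adm)).
Qed.

Lemma tensor_is_binomial_cupone_dga :
  admissible tau -> is_binomial_cupone_dga (d_tau tau).
Proof.
move=> tau_adm; split; first exact: tensor_is_cupone_dga.
- exact: tensor_deg0_binomial_algebra.
- exact: tensor_unitized_binomial_algebra.
Qed.

Lemma psi_is_morphism : is_morphism (d_tau tau) (d_bar tau) (@psi k X).
Proof.
split.
- by split; [exact: psi_linear | exact: psi_one].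
- exact: psi_cup.
- exact: psi_d.
- exact: psi_cup1.
- by move=> n u; apply: psi_zeta1.
Qed.

Lemma psi_extends_eval : extends_eval (@psi k X).
Proof. by move=> q s; rewrite psi_iota1. Qed.

Lemma psi_unique (psi' : forall n, A n -> BA n) :
    is_morphism (d_tau tau) (d_bar tau) psi' -> extends_eval psi' ->
  forall n u, psi' n u = psi u.
Proof.
move=> [[psi'_lin psi'_one] psi'_cup _ _ _] psi'_eval.
apply: tensor_alg_morphism_ext => //.
- exact: psi_linear.
- by rewrite psi'_one psi_one.
- exact: psi_cup.
- by move=> q; apply: funext => s; rewrite psi'_eval psi_extends_eval.
Qed.

End Embedding.

Theorem theorem1p2 (k : coef) (X : choiceType) (tau : X -> tpow (maug k X) 2) :
  admissible tau ->
  [/\ unique (is_d_tau tau) (d_tau tau),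
      forall n (u : tensor_alg k X n), d_tau tau (d_tau tau u) = 0,
      is_binomial_cupone_dga (d_tau tau),
      is_binomial_cupone_dga (d_bar tau)
    & exists psi : forall n, tensor_alg k X n -> bar_alg k X n,
      [/\ is_morphism (d_tau tau) (d_bar tau) psi,
          extends_eval psi,
          forall n, injective (psi n)
        & forall psi' : forall n, tensor_alg k X n -> bar_alg k X n,
            is_morphism (d_tau tau) (d_bar tau) psi' ->
            extends_eval psi' -> forall n u, psi' n u = psi n u]].
Proof.
move=> tau_adm; split.
- exact: d_tau_unique.
- by have [[_ _ dd0 _] _ _ _] := tensor_is_cupone_dga tau_adm.
- exact: tensor_is_binomial_cupone_dga.
- exact: bar_is_binomial_cupone_dga.
exists (@psi k X); split.
- exact: psi_is_morphism.
- exact: psi_extends_eval.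
- exact: psi_inj.
- exact: psi_unique.
Qed.
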